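(* Let $\pi=(n_1,\ldots,n_m)$ be a partition of $n$, $\mathcal{O}\in\mathcal{B}_{sg}^{(m)}$, and let $A\ne0$ be a real symmetric matrix of order $n$ partitioned into blocks according to $\pi$. Let the sequence $(A^{(k)};k\ge0)$ be generated by the block Jacobi-type process $$A^{(k+1)}=F_k^TA^{(k)}F_k,\quad k\ge0;\qquad A^{(0)}=A,$$ where $F_k=\mathcal E(i(k),j(k),\widehat F_k)$, $k\ge0$, are elementary block matrices with nonsingular pivot submatrices $\widehat F_k$ and pivot pairs $(i(k),j(k))=I_{\mathcal{O}}(k)$. Assume that (A2) there is a sequence of orthogonal elementary block matrices $U_k$, $k\ge0$, with pivot pair $(i(k),j(k))$, such that $\lim_{k\to\infty}(F_k-U_k)=0$; (A3) for the diagonal block $F_{ii}^{(k)}$ of $F_k$, $i=i(k)$, one has $\sigma=\liminf_{k\to\infty}\sigma^{(k)}>0$, where $\sigma^{(k)}=\sigma_{\min}\big(F_{ii}^{(k)}\big)$. Then the following two assertions are equivalent: (i) $\displaystyle\lim_{k\to\infty}\frac{S\big(\widehat A_{ij}^{(k+1)}\big)}{\|A^{(k)}\|_F}=0$, where $\widehat A_{ij}^{(k+1)}=\widehat F_k^T\widehat A_{ij}^{(k)}\widehat F_k$ and $\widehat A_{ij}^{(k)}$ is the pivot submatrix of $A^{(k)}$ for the pair $(i,j)=(i(k),j(k))$; (ii) $\displaystyle\lim_{k\to\infty}\frac{S(A^{(k)})}{\|A^{(k)}\|_F}=0$.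
   Context: **Partitions and blocks.** A partition $\pi=(n_1,\ldots,n_m)$ of $n$ ($m\ge 2$) is a tuple of positive integers with $n_1+\cdots+n_m=n$. An $n\times n$ matrix is viewed as a block matrix $A=(A_{rs})$ with $A_{rs}$ of size $n_r\times n_s$. For a symmetric matrix $X=(x_{st})$ of any order, $S(X)=\big(\sum_{s<t}|x_{st}|^2\big)^{1/2}$; $\|\cdot\|_F$ is the Frobenius norm. The pivot submatrix of $A$ for the pair $(i,j)$, $i<j$, is $\widehat A_{ij}=\begin{bmatrix} A_{ii} & A_{ij} \\ A_{ji} & A_{jj} \end{bmatrix}$. **Elementary block matrices.** For $1\le i<j\le m$ and $\widehat F=\begin{bmatrix} F_{ii} & F_{ij} \\ F_{ji} & F_{jj} \end{bmatrix}$ of order $n_i+n_j$, the elementary block matrix $\mathcal E(i,j,\widehat F)$ with pivot pair $(i,j)$ is the $n\times n$ matrix equal to $I_n$ except that its blocks at positions $(i,i),(i,j),(j,i),(j,j)$ are $F_{ii},F_{ij},F_{ji},F_{jj}$. **Pivot sequences and equivalences.** $\mathcal P_m=\{(r,s):1\le r<s\le m\}$; $\mathbf O(\mathcal P_m)$ is the set of finite sequences of elements of $\mathcal P_m$ containing every element at least once; those of length $m(m-1)/2$ are orderings of $\mathcal P_m$. For $\mathcal O=(i_0,j_0),\ldots,(i_{T-1},j_{T-1})$, $I_{\mathcal O}(k)=(i_{k\bmod T},j_{k\bmod T})$. $\mathcal O\sim\mathcal O'$: one is obtained from the other by finitely many transpositions of adjacent terms $(i_r,j_r),(i_{r+1},j_{r+1})$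 with $\{i_r,j_r\}\cap\{i_{r+1},j_{r+1}\}=\emptyset$. $\mathcal O\stackrel{\mathsf s}{\sim}\mathcal O'$: $\mathcal O=[\mathcal O_1,\mathcal O_2]$, $\mathcal O'=[\mathcal O_2,\mathcal O_1]$ (concatenations). $\mathcal O\stackrel{\mathsf w}{\sim}\mathcal O'$: there is a finite chain from $\mathcal O$ to $\mathcal O'$ in which adjacent terms are linked by $\sim$ or $\stackrel{\mathsf s}{\sim}$. $\mathcal O(\mathsf q)=(\mathsf q(i_0),\mathsf q(j_0)),\ldots$, where a pair $(a,b)$ with $a>b$ is replaced by $(b,a)$; $\mathcal O'\stackrel{\mathsf p}{\sim}\mathcal O$ if $\mathcal O'=\mathcal O(\mathsf q)$ for some permutation $\mathsf q$ of $\{1,\ldots,m\}$. $\mathcal O^{\leftarrow}$ is $\mathcal O$ written in reverse order. **Classes of orderings.** $\mathcal B_c^{(m)}$: orderings $(1,2),(\tau_3(1),3),(\tau_3(2),3),\ldots,(\tau_m(1),m),\ldots,(\tau_m(m-1),m)$ with $\tau_j$ a permutation of $\{1,\ldots,j-1\}$. $\mathcal B_r^{(m)}$: orderings $(m-1,m),(m-2,\widetilde\tau_{m-2}(m-1)),(m-2,\widetilde\tau_{m-2}(m)),\ldots,(1,\widetilde\tau_1(2)),\ldots,(1,\widetilde\tau_1(m))$ with $\widetilde\tau_i$ a permutation of $\{i+1,\ldots,m\}$. $\mathcal B_{sp}^{(m)}=\{\mathcal O:\ \mathcal O\text{ or }\mathcal O^{\leftarrow}\in\mathcal B_c^{(m)}\cup\mathcal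 B_r^{(m)}\}$. $\mathcal B_{sg}^{(m)}$ (generalized serial orderings) is the set of $\mathcal O\in\mathbf O(\mathcal P_m)$ such that, for some $\mathcal O'\in\mathbf O(\mathcal P_m)$ and $\mathcal O''\in\mathcal B_{sp}^{(m)}$, either $\mathcal O\stackrel{\mathsf p}{\sim}\mathcal O'\stackrel{\mathsf w}{\sim}\mathcal O''$ or $\mathcal O\stackrel{\mathsf w}{\sim}\mathcal O'\stackrel{\mathsf p}{\sim}\mathcal O''$. *)

(* Defs.v *)
From Stdlib Require Import Relation_Operators.
From HB Require Import structures.
From mathcomp Require Import all_boot all_order all_algebra all_fingroup.
From mathcomp Require Import all_classical all_reals all_analysis.

Set Implicit Arguments.
Unset Strict Implicit.
Unset Printing Implicit Defensive.

Import Order.TTheory GRing.Theory Num.Theory.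
Import numFieldNormedType.Exports.

Local Open Scope classical_set_scope.
Local Open Scope ring_scope.

Section Matrices.
Variable R : realType.

Definition frob_norm n (X : 'M[R]_n) : R :=
  Num.sqrt (\sum_(s < n) \sum_(t < n) `|X s t| ^+ 2).

Definition off_norm n (X : 'M[R]_n) : R :=
  Num.sqrt (\sum_(s < n) \sum_(t < n | (s < t)%N) `|X s t| ^+ 2).

Definition orthogonal_mx n (U : 'M[R]_n) : Prop := U^T *m U = 1%:M.

Definition singular_values n (B : 'M[R]_n) : set R :=
  [set s | 0 <= s /\ eigenvalue (B^T *m B) (s ^+ 2)].

(* The set of singular values is finite, and nonempty when n > 0, so that this
   infimum is a minimum. *)
Definition sigma_min n (B : 'M[R]_n) : R := inf (singular_values B).

End Matrices.

(* A partition of n into m parts is a function nu : 'I_m -> nat with positive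
   values, and n is \sum_r nu r, the order of the block matrices of matrix.v.
   The blocks are numbered from 0 to m - 1. *)
Section Blocks.
Variables (R : realType) (m : nat) (nu : 'I_m -> nat).
Local Notation n := (\sum_(r < m) nu r)%N.

Definition pivot_submx (A : 'M[R]_n) (i j : 'I_m) : 'M[R]_(nu i + nu j) :=
  block_mx (submxblock A i i) (submxblock A i j)
           (submxblock A j i) (submxblock A j j).

(* Since r = i does not make nu r and nu i convertible, the blocks of F go
   through conform_mx, which is a mere cast here: the dimensions always agree. *)
Definition elem_block_mx (i j : 'I_m) (F : 'M[R]_(nu i + nu j)) : 'M[R]_n :=
  \mxblock_(r, s)
    let D := submxblock (1%:M : 'M[R]_n) r s in
    if (r == i) && (s == i) then conform_mx D (ulsubmx F)
    else if (r == i) && (s == j) then conform_mx D (ursubmx F)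
    else if (r == j) && (s == i) then conform_mx D (dlsubmx F)
    else if (r == j) && (s == j) then conform_mx D (drsubmx F)
    else D.

Lemma pivot_submx_elem (i j : 'I_m) (F : 'M[R]_(nu i + nu j)) :
  i != j -> pivot_submx (elem_block_mx F) i j = F.
Proof.
move=> ij; have ji : (j == i) = false by rewrite eq_sym (negbTE ij).
rewrite /pivot_submx /elem_block_mx !mxblockK.
by rewrite !eqxx ji (negbTE ij) /= !conform_mx_id submxK.
Qed.

Lemma submxblock_elem (i j r s : 'I_m) (F : 'M[R]_(nu i + nu j)) :
  ~~ ((r \in [:: i; j]) && (s \in [:: i; j])) ->
  submxblock (elem_block_mx F) r s = submxblock 1%:M r s.
Proof.
rewrite /elem_block_mx mxblockK !inE.
by do 4?case: eqP => _.
Qed.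

End Blocks.

Section Pivots.
Variable m : nat.
Implicit Types O : seq ('I_m * 'I_m).

Definition is_pair (p : 'I_m * 'I_m) : bool := (p.1 < p.2)%N.

(* The set O(P_m). *)
Definition pivot_seq O : Prop :=
  all is_pair O /\ (forall p, is_pair p -> p \in O).

(* The pivot strategy I_O; the default value of nth is never reached when O is
   nonempty. *)
Definition pivot (hm : (1 < m)%N) O (k : nat) : 'I_m * 'I_m :=
  nth (Ordinal (ltnW hm), Ordinal hm) O (k %% size O).

Definition disjoint_pairs (p q : 'I_m * 'I_m) : bool :=
  [&& p.1 != q.1, p.1 != q.2, p.2 != q.1 & p.2 != q.2].

Definition adj_transp O O' : Prop :=
  exists O1 O2 p q, [/\ disjoint_pairs p q,
    O = O1 ++ p :: q :: O2 & O' = O1 ++ q :: p :: O2].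

Definition transp_equiv : seq ('I_m * 'I_m) -> seq ('I_m * 'I_m) -> Prop :=
  clos_refl_trans _ adj_transp.

Definition shift_equiv O O' : Prop :=
  exists O1 O2, O = O1 ++ O2 /\ O' = O2 ++ O1.

Definition weak_equiv : seq ('I_m * 'I_m) -> seq ('I_m * 'I_m) -> Prop :=
  clos_refl_trans _ (fun O O' => transp_equiv O O' \/ shift_equiv O O').

Definition sort_pair (p : 'I_m * 'I_m) : 'I_m * 'I_m :=
  if (p.1 < p.2)%N then p else (p.2, p.1).

Definition relabel (q : 'S_m) O := [seq sort_pair (q p.1, q p.2) | p <- O].

Definition perm_equiv O' O : Prop := exists q : 'S_m, O' = relabel q O.

(* Here tau j permutes the indices below j; the column j = 0 contributes
   nothing, and the column j = 1 contributes the single pair (0, 1). *)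
Definition col_order O : Prop :=
  exists tau : 'I_m -> 'S_m,
    (forall j : 'I_m, perm_on [set i : 'I_m | (i < j)%N]%SET (tau j)) /\
    O = flatten [seq [seq (tau j i, j) | i : 'I_m <- enum 'I_m & (i < j)%N]
                | j <- enum 'I_m].

Definition row_order O : Prop :=
  exists tau : 'I_m -> 'S_m,
    (forall i : 'I_m, perm_on [set j : 'I_m | (i < j)%N]%SET (tau i)) /\
    O = flatten [seq [seq (i, tau i j) | j : 'I_m <- enum 'I_m & (i < j)%N]
                | i <- rev (enum 'I_m)].

Definition serial_perm_order O : Prop :=
  (col_order O \/ row_order O) \/ (col_order (rev O) \/ row_order (rev O)).

Definition generalized_serial O : Prop :=
  pivot_seq O /\
  exists O' O'', [/\ pivot_seq O', serial_perm_order O'' &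
    (perm_equiv O O' /\ weak_equiv O' O'') \/
    (weak_equiv O O' /\ perm_equiv O' O'')].

End Pivots.

(* Main.v *)
(** Let L be the limit superior of the squared off-diagonal norms of
    A^(k)/||A^(k)||_F.  Under (i) these norms do not increase up to o(1).  Take
    an ultrafilter along which the norm at step k + N tends to L.  By
    compactness the matrices A^(k+j)/||A^(k)||_F, j <= N, and the U_(k+j)
    converge along it to matrices M_j and V_j with M_(j+1) = V_j^T M_j V_j; all
    off-diagonal norms of the M_j are equal to L, so every pivot submatrix is
    diagonal both before and after its step.  For such an exact process with
    nonsingular diagonal pivot blocks, one sweep of a column or row ordering
    forces all off-diagonal blocks to vanish: processing column j, the block
    (t, j) must vanish just before its step, and the earlier steps only multiply
    it by nonsingular blocks.  This property of an ordering survives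
    transposition of disjoint pivots, cyclic shift (with one more sweep),
    relabelling and, as exact steps are reversible, reversal.  Hence M_N is
    diagonal and L = 0.  By (A3) and a Rayleigh quotient argument the block
    (V_j)_ii is nonsingular; orthogonality then gives the same for (V_j)_jj. *)

Require Import Defs.
From HB Require Import structures.
From mathcomp Require Import all_boot all_order all_algebra all_fingroup.
From mathcomp Require Import all_classical all_reals all_analysis.
From mathcomp Require Import zify ring lra.

Set Implicit Arguments.
Unset Strict Implicit.
Unset Printing Implicit Defensive.

Import Order.TTheory GRing.Theory Num.Theory.
Import numFieldNormedType.Exports.

Local Open Scope classical_set_scope.
Local Open Scope ring_scope.

(** * Exact processes and generalized serial orderings *)

Section ExactProcess.
Variables (R : fieldType) (m : nat).

Definition in_pair (p : 'I_m * 'I_m) (r : 'I_m) : bool := (r == p.1) || (r == p.2).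

Section BlockMap.
Variables (n : nat) (b : 'I_n -> 'I_m).
Implicit Types (B U : 'M[R]_n) (p : 'I_m * 'I_m) (x : 'rV[R]_n).

(** The block structure is carried by the map [b] alone and blocks need not be contiguous, so that
    relabelling the blocks is a mere change of [b]. *)
Definition elem_pattern p U : Prop :=
  forall s t, ~~ (in_pair p (b s) && in_pair p (b t)) -> U s t = (s == t)%:R.

(* For x supported in block i, (x U)_i = x_i U_ii: this says that the diagonal
   block U_ii is nonsingular. *)
Definition block_inj U (i : 'I_m) : Prop :=
  forall x, (forall s, b s != i -> x 0 s = 0) ->
    (forall t, b t = i -> (x *m U) 0 t = 0) -> x = 0.

Definition pivot_diag p B : Prop :=
  forall s t, s != t -> in_pair p (b s) -> in_pair p (b t) -> B s t = 0.

Definition block_zero (r s : 'I_m) B : Prop :=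
  forall k l, b k = r -> b l = s -> B k l = 0.

Definition block_diag (S : pred 'I_m) B : Prop :=
  forall r s, S r -> S s -> r != s -> block_zero r s B.

(** The conditions on [U] and on [U^T] come together so that the notion is stable under
    transposition, which undoes a step. *)
Definition pivot_mx p U : Prop :=
  [/\ U^T *m U = 1%:M, elem_pattern p U,
      block_inj U p.1 /\ block_inj U^T p.1 & block_inj U p.2 /\ block_inj U^T p.2].

(* The pivot submatrix is required to be diagonal before the step as well: this
   makes the process reversible, and it holds for limits along which the
   off-diagonal norm no longer decreases. *)
Definition exact_step p B B' : Prop :=
  [/\ p.1 != p.2, B^T = B, pivot_diag p B, pivot_diag p B' &
      exists2 U, pivot_mx p U & B' = U^T *m B *m U].

Fixpoint exact_proc (w : seq ('I_m * 'I_m)) B B' : Prop :=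
  if w is p :: w' then exists2 B1, exact_step p B B1 & exact_proc w' B1 B'
  else B = B'.

Lemma exact_step_sym p B B' : exact_step p B B' -> B'^T = B'.
Proof.
by case=> _ Bs _ _ [U _ ->]; rewrite !trmx_mul trmxK Bs mulmxA.
Qed.

Lemma exact_proc_cat w1 w2 B B' :
  exact_proc (w1 ++ w2) B B' <->
  exists2 B1, exact_proc w1 B B1 & exact_proc w2 B1 B'.
Proof.
elim: w1 B => [|p w1 IH] B /=; first by split=> [|[B1 -> //]]; exists B.
split=> [[B1 ? /IH [B2 ? ?]]|[B2 [B1 ? ?] ?]].
  by exists B2 => //; exists B1.
by exists B1 => //; apply/IH; exists B2.
Qed.

Lemma exact_proc_sym w B B' : B^T = B -> exact_proc w B B' -> B'^T = B'.
Proof.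
elim: w B => [|p w IH] B Bs /=; first by move=> <-.
by case=> B1 /exact_step_sym Bs1; exact: IH.
Qed.

Lemma block_zeroC r s B : B^T = B -> block_zero r s B -> block_zero s r B.
Proof. by move=> Bs Z k l hk hl; rewrite -Bs mxE; apply: Z. Qed.

Lemma elem_pattern_tr p U : elem_pattern p U -> elem_pattern p U^T.
Proof. by move=> h s t; rewrite andbC => /h; rewrite mxE eq_sym. Qed.

Lemma mul_elem_out q p U (B : 'M[R]_(q, n)) s t : elem_pattern p U -> ~~ in_pair p (b t) ->
  (B *m U) s t = B s t.
Proof.
move=> hU ht; rewrite mxE (bigD1 t) //= hU ?negb_and ?ht ?orbT // eqxx mulr1.
rewrite big1 ?addr0 // => k kt.
by rewrite hU ?negb_and ?ht ?orbT // (negbTE kt) mulr0.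
Qed.

Lemma tr_elem_mul_out p U B s t : elem_pattern p U -> ~~ in_pair p (b s) ->
  (U^T *m B) s t = B s t.
Proof.
move=> hU hs; transitivity ((U^T *m B)^T t s); first by rewrite [RHS]mxE.
by rewrite trmx_mul trmxK (mul_elem_out _ _ hU) // mxE.
Qed.

Lemma step_out p U B s t : elem_pattern p U ->
  ~~ in_pair p (b s) -> ~~ in_pair p (b t) -> (U^T *m B *m U) s t = B s t.
Proof.
by move=> hU hs ht; rewrite (mul_elem_out _ _ hU) // (tr_elem_mul_out _ _ hU).
Qed.

Lemma exact_step_out p B B' s t : exact_step p B B' ->
  ~~ in_pair p (b s) -> ~~ in_pair p (b t) -> B' s t = B s t.
Proof. by case=> _ _ _ _ [U [_ hU _ _] ->]; apply: step_out. Qed.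

Lemma exact_step_row p B B' : exact_step p B B' ->
  exists2 U, pivot_mx p U & forall s t, ~~ in_pair p (b s) ->
    B' s t = \sum_k B s k * U k t.
Proof.
case=> _ _ _ _ [U hU ->]; exists U => // s t hs.
rewrite mxE; apply: eq_bigr => k _.
by case: hU => _ hU _ _; rewrite (tr_elem_mul_out _ _ hU).
Qed.

Lemma exact_step_zero_out p B B' r s : exact_step p B B' ->
  ~~ in_pair p r -> ~~ in_pair p s -> block_zero r s B -> block_zero r s B'.
Proof.
move=> h hr hs Z k l hk hl; rewrite (exact_step_out h) ?hk ?hl //.
exact: Z.
Qed.

Lemma exact_step_zero_row p B B' r : exact_step p B B' -> ~~ in_pair p r ->
  block_zero r p.1 B -> block_zero r p.2 B ->
  block_zero r p.1 B' /\ block_zero r p.2 B'.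
Proof.
move=> /exact_step_row [U [_ hU _ _] hB'] hr Z1 Z2.
suff main t k : b k = r -> in_pair p (b t) -> B' k t = 0.
  by split=> k l hk hl; apply: main; rewrite ?hl // /in_pair eqxx ?orbT.
move=> hk ht; rewrite hB' ?hk // big1 // => l _.
have [hl|hl] := boolP (in_pair p (b l)).
  suff -> : B k l = 0 by rewrite mul0r.
  by case/orP: hl => /eqP; [exact: Z1|exact: Z2].
rewrite hU ?negb_and ?hl //; case: eqP => [lt|_]; last by rewrite mulr0.
by rewrite lt ht in hl.
Qed.

(** Since block [(r, p.1)] of [B] vanishes, block [(r, p.2)] of [B'] is that of [B] times the
    diagonal block of [U] at [p.2]. This factor is nonsingular, so vanishing can be pulled back
    through the step. *)
Lemma exact_step_zero_inj p B B' r : exact_step p B B' -> ~~ in_pair p r ->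
  block_zero r p.1 B -> block_zero r p.2 B' -> block_zero r p.2 B.
Proof.
move=> h hr Z1 Z2'; have p12 : p.1 != p.2 by case: h.
have [U [_ hU _ [hinj _]] hB'] := exact_step_row h.
move=> k l hk hl.
(* This is row [k] of block [(r, p.2)], padded with zeros. *)
pose x : 'rV[R]_n := \row_t (if b t == p.2 then B k t else 0).
suff x0 : x = 0 by have := congr1 (fun y : 'rV_n => y 0 l) x0; rewrite !mxE hl eqxx.
apply: hinj => [s /negbTE hs|t ht]; first by rewrite mxE hs.
rewrite -(Z2' k t hk ht) hB' ?hk // mxE; apply: eq_bigr => q _; rewrite mxE.
case: (altP (b q =P p.2)) => [//|hq].
have [/eqP hq1|hq1] := boolP (b q == p.1); first by rewrite (Z1 k q hk hq1).
rewrite hU; last by rewrite /in_pair (negbTE hq1) (negbTE hq).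
by case: eqP => [qt|_]; rewrite ?mulr0 //; rewrite qt ht eqxx in hq.
Qed.

Lemma pivot_diag_zero p B : p.1 != p.2 -> pivot_diag p B -> block_zero p.1 p.2 B.
Proof.
move=> p12 h k l hk hl; apply: h; rewrite /in_pair ?hk ?hl ?eqxx ?orbT //.
by apply: contraNneq p12 => kl; rewrite -hk -hl kl.
Qed.

Lemma exact_step_zero_pivot p B B' : exact_step p B B' -> block_zero p.1 p.2 B.
Proof. by case=> p12 _ + _ _; apply: pivot_diag_zero. Qed.

Lemma exact_step_zero_pivot' p B B' : exact_step p B B' -> block_zero p.1 p.2 B'.
Proof. by case=> p12 _ _ + _; apply: pivot_diag_zero. Qed.

Lemma exact_step_block_diag (S : pred 'I_m) p B B' : exact_step p B B' ->
  S p.1 -> S p.2 -> block_diag S B -> block_diag S B'.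
Proof.
move=> h S1 S2 hB; have Bs' := exact_step_sym h; have [p12 Bs _ _ _] := h.
have row r : S r -> ~~ in_pair p r -> block_zero r p.1 B' /\ block_zero r p.2 B'.
  move=> Sr hr; have := hr; rewrite negb_or => /andP[r1 r2].
  by apply: (exact_step_zero_row h hr); apply: hB.
move=> r s Sr Ss rs; have [hr|hr] := boolP (in_pair p r); last first.
  have [hs|hs] := boolP (in_pair p s).
    by case: (row _ Sr hr) => ? ?; case/orP: hs => /eqP ->.
  by apply: (exact_step_zero_out h) => //; apply: hB.
have [hs|hs] := boolP (in_pair p s); last first.
  by apply: block_zeroC => //; case: (row _ Ss hs) => ? ?; case/orP: hr => /eqP ->.
have Z := exact_step_zero_pivot' h.
by case/orP: hr rs => /eqP ->; case/orP: hs => /eqP ->; rewrite ?eqxx // => _;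
  apply: block_zeroC.
Qed.

Lemma exact_proc_block_diag (S : pred 'I_m) w B B' : exact_proc w B B' ->
  all (fun p => S p.1 && S p.2) w -> block_diag S B -> block_diag S B'.
Proof.
elim: w B => [|p w IH] B /=; first by move=> ->.
case=> B1 h /IH {}IH /andP[/andP[S1 S2] /IH {}IH] hB; apply: IH.
exact: exact_step_block_diag h S1 S2 hB.
Qed.

Lemma exact_proc_block_diagT w B B' : exact_proc w B B' ->
  block_diag predT B -> block_diag predT B'.
Proof. by move=> h; apply: exact_proc_block_diag h _; apply/allP. Qed.

Lemma pivot_mx_tr p U : pivot_mx p U -> pivot_mx p U^T.
Proof.
case=> orthU e [i1 i1'] [i2 i2']; split; rewrite ?trmxK //.
- exact: mulmx1C.
- exact: elem_pattern_tr.
Qed.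

Lemma exact_step_rev p B B' : exact_step p B B' -> exact_step p B' B.
Proof.
move=> h; have Bs' := exact_step_sym h.
case: h => p12 Bs d d' [U hU hB']; split=> //.
exists U^T; first exact: pivot_mx_tr.
have o : U *m U^T = 1%:M by case: hU => /mulmx1C.
by rewrite trmxK hB' !mulmxA o mul1mx -mulmxA o mulmx1.
Qed.

Lemma exact_proc_rev w B B' : exact_proc w B B' -> exact_proc (rev w) B' B.
Proof.
elim: w B => [|p w IH] B /=; first by move=> ->.
case=> B1 h /IH h'; rewrite rev_cons -cats1; apply/exact_proc_cat.
by exists B1 => //; exists B => //; apply: exact_step_rev.
Qed.

Definition disjoint_pair (p q : 'I_m * 'I_m) := forall r, in_pair p r -> ~~ in_pair q r.

Lemma disjoint_pairC p q : disjoint_pair p q -> disjoint_pair q p.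
Proof. by move=> h r; apply: contraL => /h. Qed.

Lemma elem_pattern_comm p q U V : disjoint_pair p q ->
  elem_pattern p U -> elem_pattern q V -> U *m V = V *m U.
Proof.
(* It suffices to compare columns outside one of the two pairs: by disjointness every column is
   outside [p] or outside [q], and the roles can be exchanged. *)
have half p' q' (U' V' : 'M[R]_n) s t : disjoint_pair p' q' ->
    elem_pattern p' U' -> elem_pattern q' V' -> ~~ in_pair q' (b t) ->
    (U' *m V') s t = (V' *m U') s t.
  move=> d hU hV ht; rewrite (mul_elem_out _ _ hV) // [RHS]mxE.
  have [hs|hs] := boolP (in_pair q' (b s)); last first.
    rewrite (bigD1 s) //= hV ?negb_and ?hs // eqxx mul1r big1 ?addr0 // => k ks.
    by rewrite hV ?negb_and ?hs // eq_sym (negbTE ks) mul0r.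
  have hs' : ~~ in_pair p' (b s) by apply: (disjoint_pairC d).
  rewrite hU ?negb_and ?hs' //.
  case: (altP (s =P t)) => [st|st]; first by rewrite st (negbTE ht) in hs.
  rewrite big1 // => k _; have [hk|hk] := boolP (in_pair q' (b k)).
    rewrite hU; last by rewrite negb_and (disjoint_pairC d hk).
    by case: (altP (k =P t)) => [kt|_]; rewrite ?mulr0 //; rewrite -kt hk in ht.
  rewrite hV ?negb_and ?hk ?orbT //.
  by case: (altP (s =P k)) => [sk|_]; rewrite ?mul0r //; rewrite -sk hs in hk.
move=> d hU hV; apply/matrixP => s t.
have [ht|ht] := boolP (in_pair q (b t)); last exact: (half p q).
symmetry; apply: (half q p) => //; first exact: disjoint_pairC.
exact: (disjoint_pairC d).
Qed.

(** The swapped process passes through [V^T *m B *m V]. Each update leaves the pivot submatrix of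
    the other unchanged, so the diagonality conditions carry over, and [U] and [V] commute. *)
Lemma exact_step_swap p q B B1 B2 : disjoint_pair p q ->
  exact_step p B B1 -> exact_step q B1 B2 ->
  exists2 B1', exact_step q B B1' & exact_step p B1' B2.
Proof.
move=> d hp hq; have d' := disjoint_pairC d.
have [p12 Bs dp dp' [U hU hB1]] := hp; have [q12 Bs1 dq dq' [V hV hB2]] := hq.
have [_ eU _ _] := hU; have [_ eV _ _] := hV.
have cUV := elem_pattern_comm d eU eV.
have eqB2 : B2 = U^T *m (V^T *m B *m V) *m U.
  by rewrite hB2 hB1 !mulmxA -trmx_mul -mulmxA cUV trmx_mul !mulmxA.
have oq s : in_pair q (b s) -> ~~ in_pair p (b s) by apply: d'.
have op s : in_pair p (b s) -> ~~ in_pair q (b s) by apply: d.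
exists (V^T *m B *m V); split=> //.
- by move=> s t st hs ht; rewrite -(dq s t) // hB1 (step_out _ eU) ?oq.
- by move=> s t st hs ht; rewrite -(dq' s t) // eqB2 (step_out _ eU) ?oq.
- by exists V.
- by rewrite !trmx_mul trmxK Bs mulmxA.
- by move=> s t st hs ht; rewrite (step_out _ eV) ?op //; apply: dp.
- by move=> s t st hs ht; rewrite hB2 (step_out _ eV) ?op //; apply: dp'.
- by exists U.
Qed.

(** Pairs may be read in either order: this absorbs [sort_pair] in relabellings and lets row
    orderings be treated as column orderings. *)
Lemma exact_step_flip p B B' : exact_step p B B' -> exact_step (p.2, p.1) B B'.
Proof.
have e r : in_pair (p.2, p.1) r = in_pair p r by rewrite /in_pair orbC.
case=> p12 Bs d d' [U [orthU ep i1 i2] hB']; split=> //=; first by rewrite eq_sym.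
- by move=> s t; rewrite !e; apply: d.
- by move=> s t; rewrite !e; apply: d'.
- by exists U => //; split=> // s t; rewrite !e; apply: ep.
Qed.

Lemma exact_proc_flip w B B' :
  exact_proc w B B' -> exact_proc [seq (p.2, p.1) | p <- w] B B'.
Proof.
elim: w B => [//|p w IH] B /= [B1 h /IH h']; exists B1 => //.
exact: exact_step_flip.
Qed.

(* The pivot block (t, j) vanishes just before its step, and each earlier step
   multiplies it by a nonsingular diagonal block. *)
Lemma column_zero ts j B B' : uniq ts -> j \notin ts ->
  block_diag (mem ts) B -> exact_proc [seq (t, j) | t <- ts] B B' ->
  forall t, t \in ts -> block_zero t j B.
Proof.
elim: ts B => [|u ts IH] B; first by move=> _ _ _ _ t; rewrite in_nil.
move=> /= /andP[uts uniq_ts].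
rewrite inE negb_or => /andP[ju jts] hB [B1 h /IH {}IH] t.
rewrite inE; have [-> _|tu /= tts] := eqVneq t u; first exact: exact_step_zero_pivot h.
have tj : t != j by apply: contraNneq jts => <-.
have out r : r \in ts -> ~~ in_pair (u, j) r.
  move=> rts; rewrite /in_pair /= negb_or; apply/andP; split.
    by apply: contraNneq uts => <-.
  by apply: contraNneq jts => <-.
apply: (exact_step_zero_inj h) => /=; first exact: out.
  by apply: hB; rewrite ?inE ?eqxx ?tts ?orbT.
apply: IH => // r s /= rts sts rs.
by apply: (exact_step_zero_out h); rewrite ?out //; apply: hB; rewrite /= ?inE ?rts ?sts ?orbT.
Qed.

(** A common form of column and row orderings, with [lt] the order in which indices are reached. The
    invariant is block diagonality on the indices [pre] already reached; [column_zero] shows that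
    the next column [j] vanishes over [pre], so the invariant extends to [j]. *)
Lemma nested_block_diag (lt : rel 'I_m) (ts : 'I_m -> seq 'I_m) js pre B B' :
  irreflexive lt -> transitive lt -> B^T = B ->
  (forall j, uniq (ts j)) -> (forall j t, (t \in ts j) = lt t j) ->
  pairwise lt (pre ++ js) -> (forall r, r \in pre ++ js) ->
  block_diag (mem pre) B ->
  exact_proc (flatten [seq [seq (t, j) | t <- ts j] | j <- js]) B B' ->
  block_diag predT B'.
Proof.
move=> ltxx lt_trans + uts mts.
elim: js pre B => [|j js IH] pre B Bs.
  by rewrite cats0 => _ hpre hB /= <- r s _ _; apply: hB; apply: hpre.
move=> pw hmem hB /= /exact_proc_cat[B1 h1 h2].
(* The list is sorted and exhausts all indices, so those below [j] are exactly those already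
   reached. *)
have mpre r : (r \in ts j) = (r \in pre).
  rewrite mts; move: pw; rewrite pairwise_cat /= => /and3P[/allrelP pj _ /andP[/allP jj _]].
  apply/idP/idP => [rj|rpre]; last by apply: pj; rewrite ?inE ?eqxx.
  have := hmem r; rewrite mem_cat inE => /or3P[//|/eqP rE|/jj jr].
    by rewrite rE ltxx in rj.
  by have := lt_trans _ _ _ rj jr; rewrite ltxx.
have Bs1 := exact_proc_sym Bs h1.
apply: (IH (rcons pre j) B1) => //; rewrite ?cat_rcons //.
apply: (exact_proc_block_diag h1).
  apply/allP => p /mapP[t]; rewrite mpre => tpre ->.
  by rewrite /= !mem_rcons !inE eqxx tpre orbT.
have Z : forall t, t \in ts j -> block_zero t j B.
  apply: (column_zero (uts j) _ _ h1); first by rewrite mts ltxx.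
  by move=> r s /=; rewrite !mpre; apply: hB.
move=> r s /=; rewrite !mem_rcons !inE.
have [->|rj] := eqVneq r j => /= [_|rpre]; have [->|sj] := eqVneq s j => /= [_|spre].
- by [].
- by move=> _; apply: block_zeroC => //; apply: Z; rewrite mpre.
- by move=> _; apply: Z; rewrite mpre.
- exact: hB.
Qed.

(** Subtracting the diagonal lets [block_zero] express that the diagonal block [r] is itself a
    diagonal matrix. A step meeting [r] creates this property, and a step avoiding [r] keeps it. *)
Lemma exact_step_out_diag p B B' : exact_step p B B' -> forall r,
  block_zero r r (B - diag_mx (\row_s B s s)) \/ in_pair p r ->
  block_zero r r (B' - diag_mx (\row_s B' s s)).
Proof.
move=> h r H k l hk hl; rewrite !mxE.
case: (altP (k =P l)) => [<-|kl]; first by rewrite mulr1n subrr.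
rewrite mulr0n subr0; have [hr|hr] := boolP (in_pair p r).
  by case: h => _ _ _ d' _; apply: d'; rewrite ?hk ?hl.
rewrite (exact_step_out h) ?hk ?hl //; case: H => [/(_ k l hk hl)|H]; last by rewrite H in hr.
by rewrite !mxE (negbTE kl) mulr0n subr0.
Qed.

Lemma exact_proc_diag_block w B B' r : exact_proc w B B' ->
  block_zero r r (B - diag_mx (\row_s B s s)) \/ has (in_pair^~ r) w ->
  block_zero r r (B' - diag_mx (\row_s B' s s)).
Proof.
elim: w B => [|p w IH] B /=; first by move=> -> [].
case=> B1 h /IH hw H; apply: hw.
case: H => [H|/orP[H|->]]; [left|left|by right].
- by apply: (exact_step_out_diag h); left.
- by apply: (exact_step_out_diag h); right.
Qed.

Lemma exact_proc_diag w B B' : exact_proc w B B' -> block_diag predT B' ->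
  (forall r, has (in_pair^~ r) w) -> forall s t, s != t -> B' s t = 0.
Proof.
move=> h hB' hw s t st; have [e|ne] := eqVneq (b s) (b t); last exact: hB' ne _ _ _ _.
have := @exact_proc_diag_block w B B' (b s) h (or_intror (hw _)) s t erefl (esym e).
by rewrite !mxE (negbTE st) mulr0n subr0.
Qed.

End BlockMap.
Lemma exact_step_relabel n (b : 'I_n -> 'I_m) (q : 'S_m) p (B B' : 'M[R]_n) :
  exact_step b (q p.1, q p.2) B B' -> exact_step ((q^-1)%g \o b) p B B'.
Proof.
have f k i : (b k == q i) = ((q^-1)%g (b k) == i).
  by rewrite -(inj_eq (@perm_inj _ q) _ i) permKV.
have e k : in_pair (q p.1, q p.2) (b k) = in_pair p ((q^-1)%g (b k)).
  by rewrite /in_pair /= !f.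
have inj i (U : 'M[R]_n) : block_inj b U (q i) -> block_inj ((q^-1)%g \o b) U i.
  move=> h x hx hxU; apply: h => [s|t]; first by rewrite f; apply: hx.
  by move/eqP; rewrite f => /eqP; apply: hxU.
case=> /= p12 Bs d d' [U [orthU eU [i1 i1'] [i2 i2']] hB']; split=> //.
- by apply: contraNneq p12 => ->.
- by move=> s t; rewrite -!e; apply: d.
- by move=> s t; rewrite -!e; apply: d'.
- exists U => //; split=> //; try by split; apply: inj.
  by move=> s t; rewrite -!e; apply: eU.
Qed.

Lemma exact_proc_relabel n (b : 'I_n -> 'I_m) (q : 'S_m) w (B B' : 'M[R]_n) :
  exact_proc b (relabel q w) B B' -> exact_proc ((q^-1)%g \o b) w B B'.
Proof.
elim: w B => [//|p w IH] B /= [B1 h /IH h']; exists B1 => //.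
apply: exact_step_relabel; move: h; rewrite /sort_pair /=; case: ifP => // _.
exact: exact_step_flip.
Qed.

(** * Repeated sweeps, and orderings that force block diagonality *)

Definition word_pow K (w : seq ('I_m * 'I_m)) := flatten (nseq K w).

Lemma word_powSr K w : word_pow K.+1 w = word_pow K w ++ w.
Proof. by rewrite /word_pow -addn1 nseqD flatten_cat /= cats0. Qed.

Lemma word_pow_cat_comm K w1 w2 :
  w1 ++ word_pow K (w2 ++ w1) = word_pow K (w1 ++ w2) ++ w1.
Proof.
elim: K => [|K IH]; first by rewrite /word_pow /= cats0.
by rewrite -[word_pow K.+1 (w2 ++ w1)]/(_ ++ word_pow K _) -!catA IH !catA.
Qed.

Lemma rev_word_pow K w : rev (word_pow K w) = word_pow K (rev w).
Proof.
elim: K => [//|K IH]; rewrite word_powSr rev_cat IH.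
by rewrite -[RHS]/(rev w ++ word_pow K (rev w)).
Qed.

(** The quantification over [b] makes the property stable under relabelling, and the free number [K]
    of sweeps leaves room for cyclic shifts. *)
Definition forces_block_diag w : Prop :=
  exists K, forall n (b : 'I_n -> 'I_m) (B B' : 'M[R]_n), B^T = B ->
    exact_proc b (word_pow K w) B B' -> block_diag b predT B'.

Lemma forces_imp w w' :
  (forall n (b : 'I_n -> 'I_m) (B B' : 'M[R]_n), exact_proc b w' B B' ->
     exact_proc b w B B') ->
  forces_block_diag w -> forces_block_diag w'.
Proof.
move=> h [K hK]; exists K => n b B B' Bs h'; apply: (hK _ _ _ _ Bs).
elim: K B h' {hK Bs} => [//|K IH] B.
rewrite -![word_pow K.+1 _]/(_ ++ word_pow K _).
by case/exact_proc_cat => B1 /h h1 /IH h2; apply/exact_proc_cat; exists B1.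
Qed.

(** Run backwards, the process follows [w] and ends in [B], which is therefore block diagonal; this
    then propagates forwards to [B']. *)
Lemma forces_rev w : forces_block_diag w -> forces_block_diag (rev w).
Proof.
move=> [K hK]; exists K => n b B B' Bs h.
apply: (exact_proc_block_diagT h); have Bs' := exact_proc_sym Bs h.
by apply: hK Bs' _; rewrite -(revK w) -rev_word_pow; apply: exact_proc_rev.
Qed.

(** [K.+1] sweeps of [w2 ++ w1] consist of [w2], then [K] sweeps of [w1 ++ w2], then [w1], and the
    last part preserves block diagonality. *)
Lemma forces_shift w1 w2 : forces_block_diag (w1 ++ w2) -> forces_block_diag (w2 ++ w1).
Proof.
move=> [K hK]; exists K.+1 => n b B B' Bs.
rewrite -[word_pow K.+1 _]/((w2 ++ w1) ++ word_pow K _) -catA word_pow_cat_comm.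
case/exact_proc_cat=> B1 h1 /exact_proc_cat[B2 h2 h3].
apply: (exact_proc_block_diagT h3); exact: hK (exact_proc_sym Bs h1) h2.
Qed.

Lemma forces_relabel q w : forces_block_diag w -> forces_block_diag (relabel q w).
Proof.
move=> [K hK]; exists K => n b B B' Bs h.
have h' : exact_proc ((q^-1)%g \o b) (word_pow K w) B B'.
  apply: exact_proc_relabel; move: h.
  by rewrite /relabel /word_pow map_flatten map_nseq.
move=> r s _ _ rs k l hk hl.
apply: (hK _ _ _ _ Bs h' ((q^-1)%g r) ((q^-1)%g s)) => //=; rewrite ?hk ?hl //.
by rewrite (inj_eq perm_inj).
Qed.

Lemma forces_transp w w' : adj_transp w w' ->
  forces_block_diag w -> forces_block_diag w'.
Proof.
move=> [w1 [w2 [p [q [d -> ->]]]]]; apply: forces_imp => n b B B'.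
case/exact_proc_cat => B1 h1 [B2 hq [B3 hp h2]]; apply/exact_proc_cat; exists B1 => //.
have d' : disjoint_pair q p.
  move: d => /and4P[d1 d2 d3 d4] r /orP[] /eqP ->; rewrite /in_pair negb_or.
    by rewrite eq_sym d1 eq_sym d3.
  by rewrite eq_sym d2 eq_sym d4.
by have [B2' ? ?] := exact_step_swap d' hq hp; exists B2' => //; exists B3.
Qed.

Lemma adj_transp_sym (w w' : seq ('I_m * 'I_m)) : adj_transp w w' -> adj_transp w' w.
Proof.
move=> [w1 [w2 [p [q [/and4P[d1 d2 d3 d4] -> ->]]]]].
exists w1, w2, q, p; split=> //.
by rewrite /disjoint_pairs ![q.1 == _]eq_sym ![q.2 == _]eq_sym d1 d2 d3 d4.
Qed.

Lemma forces_weak w w' : weak_equiv w w' ->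
  forces_block_diag w' -> forces_block_diag w.
Proof.
elim=> {w w'} [w w' [h|]|//|w1 w2 w3 _ IH1 _ IH2 /IH2 /IH1 //].
  elim: h => {w w'} [w w' /adj_transp_sym /forces_transp //|//|].
  by move=> w1 w2 w3 _ IH1 _ IH2 /IH2 /IH1.
by move=> [w1 [w2 [-> ->]]]; apply: forces_shift.
Qed.

Lemma mem_perm_below (P : pred 'I_m) (tau : 'S_m) t :
  perm_on [set i | P i]%SET tau ->
  (t \in [seq tau i | i <- enum 'I_m & P i]) = P t.
Proof.
move=> htau; rewrite -{1}(permKV tau t) mem_map; last exact: perm_inj.
rewrite mem_filter mem_enum andbT.
by have := perm_closed ((tau^-1)%g t) htau; rewrite permKV !inE => <-.
Qed.

Lemma block_diag0 n (b : 'I_n -> 'I_m) (B : 'M[R]_n) : block_diag b (mem [::]) B.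
Proof. by move=> r s /=; rewrite in_nil. Qed.

Lemma pairwise_enum_ord : pairwise (fun i j : 'I_m => (i < j)%N) (enum 'I_m).
Proof.
have := iota_ltn_sorted 0 m.
by rewrite (sorted_pairwise ltn_trans) -val_enum_ord pairwise_map.
Qed.

Lemma forces_col w : col_order w -> forces_block_diag w.
Proof.
move=> [tau [htau ->]]; exists 1%N => n b B B' Bs; rewrite /word_pow /= cats0 => h.
pose ts (j : 'I_m) := [seq tau j i | i : 'I_m <- enum 'I_m & (i < j)%N].
apply: (@nested_block_diag _ b (fun i j : 'I_m => (i < j)%N) ts (enum 'I_m) [::] B B').
- by move=> i /=; rewrite ltnn.
- by move=> i j k /=; apply: ltn_trans.
- by [].
- by move=> j; rewrite (map_inj_uniq (@perm_inj _ _)) filter_uniq ?enum_uniq.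
- by move=> j t; apply: mem_perm_below.
- exact: pairwise_enum_ord.
- by move=> r; rewrite cat0s mem_enum.
- exact: block_diag0.
- by move: h; congr (exact_proc _ (flatten _) _ _); apply: eq_map => j; rewrite -map_comp.
Qed.

(** After flipping the pairs, row [i] becomes a column, and the ordering is a column ordering for
    the reversed order of the indices. *)
Lemma forces_row w : row_order w -> forces_block_diag w.
Proof.
move=> [tau [htau ->]]; exists 1%N => n b B B' Bs; rewrite /word_pow /= cats0.
move=> /exact_proc_flip h.
pose ts (i : 'I_m) := [seq tau i j | j : 'I_m <- enum 'I_m & (i < j)%N].
apply: (@nested_block_diag _ b (fun i j : 'I_m => (j < i)%N) ts (rev (enum 'I_m)) [::] B B').
- by move=> i /=; rewrite ltnn.
- by move=> i j k /= ij jk; apply: ltn_trans jk ij.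
- by [].
- by move=> j; rewrite (map_inj_uniq (@perm_inj _ _)) filter_uniq ?enum_uniq.
- by move=> j t; apply: mem_perm_below.
- rewrite cat0s -sorted_pairwise; last by move=> i j k /= ij jk; apply: ltn_trans jk ij.
  rewrite rev_sorted sorted_pairwise; first exact: pairwise_enum_ord.
  by move=> i j k /=; apply: ltn_trans.
- by move=> r; rewrite cat0s mem_rev mem_enum.
- exact: block_diag0.
- move: h; rewrite map_flatten -map_comp; congr (exact_proc _ (flatten _) _ _).
  by apply: eq_map => j; rewrite /= -!map_comp.
Qed.

Lemma forces_generalized_serial w : generalized_serial w -> forces_block_diag w.
Proof.
have sp w' : serial_perm_order w' -> forces_block_diag w'.
  case=> [[/forces_col|/forces_row]|h] //; rewrite -(revK w'); apply: forces_rev.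
  by case: h => [/forces_col|/forces_row].
move=> [_ [w' [w'' [_ hw'' [[[q ->] /forces_weak h]|[/forces_weak h [q eq']]]]]]].
  exact/forces_relabel/h/sp.
by apply: h; rewrite eq'; apply/forces_relabel/sp.
Qed.

End ExactProcess.

(** * Off-diagonal norm *)

Section SumsOfSquares.
Variables (R : realType) (n : nat).
Implicit Types (X B U : 'M[R]_n).

Definition sqsum X : R := \sum_s \sum_t X s t ^+ 2.

Definition diag_sqsum X : R := \sum_s X s s ^+ 2.

(** Both triangles are counted, so for symmetric [X] this is twice the square of [off_norm X]. Being
    a polynomial, it passes to limits directly. *)
Definition off_sqsum X : R := \sum_s \sum_(t | t != s) X s t ^+ 2.

Lemma sqsum_ge0 X : 0 <= sqsum X.
Proof. by apply: sumr_ge0 => s _; apply: sumr_ge0 => t _; apply: sqr_ge0. Qed.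

Lemma off_sqsum_ge0 X : 0 <= off_sqsum X.
Proof. by apply: sumr_ge0 => s _; apply: sumr_ge0 => t _; apply: sqr_ge0. Qed.

Lemma off_sqsumE X : off_sqsum X = sqsum X - diag_sqsum X.
Proof.
rewrite -sumrB; apply: eq_bigr => s _.
by rewrite [in RHS](bigD1 s) //= addrAC subrr add0r.
Qed.

Lemma off_sqsum_le X : off_sqsum X <= sqsum X.
Proof.
by rewrite off_sqsumE lerBlDr lerDl; apply: sumr_ge0 => s _; apply: sqr_ge0.
Qed.

Lemma off_sqsum_eq0 X : off_sqsum X = 0 -> forall s t, s != t -> X s t = 0.
Proof.
move=> /eqP; rewrite psumr_eq0; last first.
  by move=> s _; apply: sumr_ge0 => t _; apply: sqr_ge0.
move=> /allP H s t st; have := H s (mem_index_enum _).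
rewrite psumr_eq0 /=; last by move=> k _; apply: sqr_ge0.
move=> /allP /(_ t (mem_index_enum _)); rewrite eq_sym st /= sqrf_eq0.
by move/eqP.
Qed.

Lemma off_sqsum_diag X : (forall s t, s != t -> X s t = 0) -> off_sqsum X = 0.
Proof.
move=> H; rewrite /off_sqsum big1 // => s _; rewrite big1 // => t ts.
by rewrite H ?expr0n // eq_sym.
Qed.

Lemma sqsum_eq0 X : sqsum X = 0 -> X = 0.
Proof.
move=> /eqP; rewrite psumr_eq0; last first.
  by move=> s _; apply: sumr_ge0 => t _; apply: sqr_ge0.
move=> /allP H; apply/matrixP => s t; have := H s (mem_index_enum _).
rewrite psumr_eq0 /=; last by move=> k _; apply: sqr_ge0.
by move=> /allP /(_ t (mem_index_enum _)); rewrite sqrf_eq0 mxE => /eqP.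
Qed.

Lemma sqr_le_sqsum X s t : X s t ^+ 2 <= sqsum X.
Proof.
rewrite /sqsum (bigD1 s) //= (bigD1 t) //= -addrA lerDl.
by apply: addr_ge0; do ?[apply: sumr_ge0 => ? _]; apply: sqr_ge0.
Qed.

Lemma sqsumZ a X : sqsum (a *: X) = a ^+ 2 * sqsum X.
Proof.
rewrite mulr_sumr; apply: eq_bigr => s _; rewrite mulr_sumr.
by apply: eq_bigr => t _; rewrite mxE exprMn.
Qed.

Lemma off_sqsumZ a X : off_sqsum (a *: X) = a ^+ 2 * off_sqsum X.
Proof.
rewrite mulr_sumr; apply: eq_bigr => s _; rewrite mulr_sumr.
by apply: eq_bigr => t _; rewrite mxE exprMn.
Qed.

Lemma sqsum_trace X : sqsum X = \tr (X *m X^T).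
Proof.
by apply: eq_bigr => s _; rewrite mxE; apply: eq_bigr => t _; rewrite mxE expr2.
Qed.

Lemma sqsum_orth U B : U^T *m U = 1%:M -> sqsum (U^T *m B *m U) = sqsum B.
Proof.
move=> /[dup] hU /mulmx1C hU'; rewrite !sqsum_trace !trmx_mul trmxK.
have -> : U^T *m B *m U *m (U^T *m (B^T *m U)) = U^T *m (B *m B^T *m U).
  by rewrite !mulmxA -(mulmxA (U^T *m B) U U^T) hU' mulmx1.
by rewrite mxtrace_mulC -(mulmxA (B *m B^T) U) hU' mulmx1.
Qed.

Lemma off_sqsum_sym X : X^T = X ->
  off_sqsum X = 2 * \sum_(s < n) \sum_(t < n | (s < t)%N) X s t ^+ 2.
Proof.
move=> Xs; rewrite mulr_natl mulr2n {2}(exchange_big_dep predT) //= -big_split /=.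
apply: eq_bigr => s _; rewrite (bigID (fun t : 'I_n => (s < t)%N)) /=.
congr (_ + _).
  by apply: eq_bigl => t; rewrite neq_ltn; case: ltngtP.
apply: eq_big => [t|t _]; last by rewrite -{1}Xs mxE.
by rewrite -val_eqE /=; case: ltngtP.
Qed.

Lemma frob_norm_sqr X : frob_norm X ^+ 2 = sqsum X.
Proof.
rewrite /frob_norm sqr_sqrtr.
  by apply: eq_bigr => s _; apply: eq_bigr => t _; rewrite real_normK ?num_real.
by apply: sumr_ge0 => s _; apply: sumr_ge0 => t _; apply: exprn_ge0.
Qed.

Lemma off_norm_sqr X : X^T = X -> off_sqsum X = 2 * off_norm X ^+ 2.
Proof.
move=> Xs; rewrite off_sqsum_sym // /off_norm sqr_sqrtr.
  congr (_ * _); apply: eq_bigr => s _; apply: eq_bigr => t _.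
  by rewrite real_normK ?num_real.
by apply: sumr_ge0 => s _; apply: sumr_ge0 => t _; apply: exprn_ge0.
Qed.

Section Pivot.
Variables (m : nat) (b : 'I_n -> 'I_m) (p : 'I_m * 'I_m).

(** The pivot submatrix padded with zeros: keeping the order [n] avoids dependent block sizes when
    the pivot varies with the step. *)
Definition pivot_mask B : 'M[R]_n :=
  \matrix_(s, t) (if in_pair p (b s) && in_pair p (b t) then B s t else 0).

Lemma pivot_maskE B : let D := diag_mx (\row_s (in_pair p (b s))%:R) in
  pivot_mask B = D *m B *m D.
Proof.
apply/matrixP => s t; rewrite mul_mx_diag mul_diag_mx !mxE.
by case: (in_pair p (b s)); case: (in_pair p (b t)); rewrite ?mul1r ?mulr1 ?mul0r ?mulr0.
Qed.

Lemma pivot_maskZ a B : pivot_mask (a *: B) = a *: pivot_mask B.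
Proof. by apply/matrixP => s t; rewrite !mxE; case: ifP; rewrite ?mulr0. Qed.

Lemma off_sqsum_mask0 B : off_sqsum (pivot_mask B) = 0 <-> pivot_diag b p B.
Proof.
split=> [/off_sqsum_eq0 H s t st hs ht|H].
  by have := H s t st; rewrite mxE hs ht.
by apply: off_sqsum_diag => s t st; rewrite mxE; case: ifP => // /andP[hs ht]; apply: H.
Qed.

Lemma off_sqsum_mask_le B : off_sqsum (pivot_mask B) <= off_sqsum B.
Proof.
apply: ler_sum => s _; apply: ler_sum => t _; rewrite mxE; case: ifP => // _.
by rewrite expr0n sqr_ge0.
Qed.

(** The classical Jacobi identity. [U] preserves the Frobenius norm of the whole matrix and, as it
    commutes with the projector [D] on the pivot indices, that of the pivot part; diagonal entries
    outside the pivot do not change. *)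
Lemma off_sqsum_step U B : U^T *m U = 1%:M -> elem_pattern b p U ->
  let B' := U^T *m B *m U in
  off_sqsum B' - off_sqsum (pivot_mask B') = off_sqsum B - off_sqsum (pivot_mask B).
Proof.
move=> hU eU B'; pose D := diag_mx (\row_s (in_pair p (b s))%:R) : 'M[R]_n.
have DU : D *m U = U *m D.
  apply/matrixP => s t; rewrite mul_mx_diag mul_diag_mx !mxE.
  have [hs|hs] := boolP (in_pair p (b s)); have [ht|ht] := boolP (in_pair p (b t)).
  - by rewrite mulr1 mul1r.
  - rewrite eU ?negb_and ?ht ?orbT //; case: eqP => [st|_]; rewrite ?mulr0 //.
    by rewrite -st hs in ht.
  - rewrite eU ?negb_and ?hs //; case: eqP => [st|_]; rewrite ?mul0r ?mulr0 //.
    by rewrite st ht in hs.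
  - by rewrite mulr0 mul0r.
have UD : U^T *m D = D *m U^T.
  by rewrite -[D]tr_diag_mx -!trmx_mul DU.
have hM : sqsum (pivot_mask B') = sqsum (pivot_mask B).
  rewrite -[RHS](sqsum_orth _ hU) !pivot_maskE -/D /B'.
  by rewrite !mulmxA -UD -!mulmxA -DU !mulmxA.
have hdiag : diag_sqsum B' - diag_sqsum (pivot_mask B')
    = diag_sqsum B - diag_sqsum (pivot_mask B).
  rewrite -!sumrB; apply: eq_bigr => s _.
  have E X : pivot_mask X s s = if in_pair p (b s) then X s s else 0.
    by rewrite mxE andbb.
  rewrite !E; have [hs|hs] := boolP (in_pair p (b s)); first by rewrite !subrr.
  by rewrite (step_out _ eU).
rewrite !off_sqsumE hM sqsum_orth //.
rewrite -[diag_sqsum B'](subrK (diag_sqsum (pivot_mask B'))) hdiag.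
ring.
Qed.

End Pivot.
End SumsOfSquares.

(** * Limits along ultrafilters *)

Lemma cvg_sum_seq (R : realType) (D : Type) (W : set_system D) {FW : Filter W}
    (I : Type) (r : seq I) (P : pred I) (f : I -> D -> R) (l : I -> R) :
  (forall i, f i @ W --> l i) ->
  (fun x => \sum_(i <- r | P i) f i x) @ W --> \sum_(i <- r | P i) l i.
Proof.
move=> fl; elim: r => [|i r IH].
  rewrite big_nil; under eq_fun do rewrite big_nil; exact: cvg_cst.
rewrite big_cons; under eq_fun do rewrite big_cons.
by case: (P i) => //; apply: cvgD.
Qed.

Section Limits.
Variables (R : realType) (W : set_system nat).

(** The image ultrafilter contains a compact segment, hence has a cluster point, and a cluster point
    of an ultrafilter is a limit. *)
Lemma ultra_bounded_cvg (u : nat -> R) (C : R) : UltraFilter W ->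
  (\forall k \near W, `|u k| <= C) -> exists l : R, u @ W --> l.
Proof.
move=> UW hC; have := @segment_compact R (- C) C.
have hI : W (u @^-1` `[- C, C]%classic).
  by apply: filterS hC => k; rewrite /= in_itv /= -ler_norml.
move=> /(_ (fmap u W) _ hI)[l [_ hl]]; exists l => N Nl.
have [//|hN] := in_ultra_setVsetC (u @^-1` N) UW.
by have [x [/= ? ?]] := hl (~` N) N hN Nl.
Qed.

(** Entrywise convergence reduces products and masks to scalar limits along an arbitrary filter. *)
Definition mxlim q r (X : nat -> 'M[R]_(q, r)) (M : 'M[R]_(q, r)) : Prop :=
  forall s t, (fun k => X k s t) @ W --> M s t.

Lemma mxlim_exists q r (X : nat -> 'M[R]_(q, r)) (C : R) : UltraFilter W ->
  (\forall k \near W, forall s t, `|X k s t| <= C) -> exists M, mxlim X M.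
Proof.
move=> UW hC.
have H s t : {l : R | (fun k => X k s t) @ W --> l}.
  by apply/cid/(ultra_bounded_cvg UW (C := C)); apply: filterS hC.
by exists (\matrix_(s, t) projT1 (H s t)) => s t; rewrite mxE; case: (H s t).
Qed.

Hypothesis PW : ProperFilter W.

Lemma mxlim_unique q r (X : nat -> 'M[R]_(q, r)) M M' :
  mxlim X M -> mxlim X M' -> M = M'.
Proof.
by move=> h h'; apply/matrixP => s t; apply: (cvg_unique (@Rhausdorff R) (h s t) (h' s t)).
Qed.

Lemma mxlim_cst q r (M : 'M[R]_(q, r)) : mxlim (fun=> M) M.
Proof. by move=> s t; apply: cvg_cst. Qed.

Lemma mxlim_mul q r d (X : nat -> 'M[R]_(q, r)) (Y : nat -> 'M[R]_(r, d)) M N :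
  mxlim X M -> mxlim Y N -> mxlim (fun k => X k *m Y k) (M *m N).
Proof.
move=> hX hY s t; rewrite mxE; under eq_fun do rewrite mxE.
by apply: cvg_sum_seq => i; apply: cvgM.
Qed.

Lemma mxlim_tr q r (X : nat -> 'M[R]_(q, r)) M :
  mxlim X M -> mxlim (fun k => (X k)^T) M^T.
Proof. by move=> hX s t; rewrite mxE; under eq_fun do rewrite mxE; apply: hX. Qed.

Lemma mxlim_mask n m (b : 'I_n -> 'I_m) p (X : nat -> 'M[R]_n) M :
  mxlim X M -> mxlim (fun k => pivot_mask b p (X k)) (pivot_mask b p M).
Proof.
move=> hX s t; rewrite mxE; under eq_fun do rewrite mxE.
by case: ifP => _; [apply: hX|apply: cvg_cst].
Qed.

Lemma cvg_sqsum n (X : nat -> 'M[R]_n) M :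
  mxlim X M -> (fun k => sqsum (X k)) @ W --> sqsum M.
Proof. by move=> hX; do 2 apply: cvg_sum_seq => ?; apply: cvgM; apply: hX. Qed.

Lemma cvg_off_sqsum n (X : nat -> 'M[R]_n) M :
  mxlim X M -> (fun k => off_sqsum (X k)) @ W --> off_sqsum M.
Proof. by move=> hX; do 2 apply: cvg_sum_seq => ?; apply: cvgM; apply: hX. Qed.

Lemma cvg_near_eq (f g : nat -> R) (l : R) :
  (\forall k \near W, f k = g k) -> f @ W --> l -> g @ W --> l.
Proof.
move=> fg fl; apply: cvg_trans fl; apply: near_eq_cvg.
by apply: filterS fg => k ->.
Qed.

Lemma mxlim_eq q r (X Y : nat -> 'M[R]_(q, r)) M :
  (\forall k \near W, X k = Y k) -> mxlim X M -> mxlim Y M.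
Proof.
move=> XY hX s t; apply: cvg_near_eq (hX s t).
by apply: filterS XY => k ->.
Qed.

End Limits.

(** * Sequences and ultrafilters at infinity *)

Section UltraConvergence.
Variable R : realType.

(** If convergence fails for some [e], the bad indices meet every tail. The tails restricted to them
    generate a proper filter, and an ultrafilter refining it contradicts the hypothesis. *)
Lemma cvg_ultraP (u : nat -> R) (l : R) :
  (forall W, UltraFilter W -> W --> \oo -> u @ W --> l) -> u @ \oo --> l.
Proof.
move=> H; apply/cvgrPdist_lt => e e0; apply: contrapT => hn.
pose F : set_system nat := within [set k | ~ `|l - u k| < e] \oo.
have PF : ProperFilter F.
  apply: Build_ProperFilter_ex => P hP.
  have {}hP : \forall k \near \oo, ~ `|l - u k| < e -> P k := hP.
  apply: contrapT => nP; apply: hn; apply: filterS hP => k hk.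
  by apply: contrapT => hk'; apply: nP; exists k; apply: hk.
have [W [UW FW]] := ultraFilterLemma PF.
have Woo : W --> \oo.
  by move=> P hP; apply: FW; rewrite /F /within /=; apply: filterS hP => k Pk _.
have /cvgrPdist_lt /(_ e e0) h := H W UW Woo.
have hF : W [set k | ~ `|l - u k| < e] by apply: FW; rewrite /F /within /=; apply: nearW.
by have [k [h1 h2]] := filter_ex (filterI h hF).
Qed.

(** Applied to residues modulo the length of the ordering, this makes the pivot pair constant along
    the ultrafilter. *)
Lemma ultra_finite_const (W : set_system nat) (h : nat -> nat) T :
  UltraFilter W -> (forall k, (h k < T)%N) -> exists c, W [set k | h k = c].
Proof.
move=> UW hT; suff H : forall T', W [set k | (h k < T')%N] -> exists c, W [set k | h k = c].
  by apply: (H T); apply: nearW.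
elim=> [hW|{hT}T' IH hW]; first by have [k] := filter_ex hW.
have [/IH //|hn] := in_ultra_setVsetC [set k | (h k < T')%N] UW.
exists T'; apply: filterS (filterI hW hn) => k [/= h1 /negP]; rewrite -leqNgt => h2.
by apply/eqP; rewrite eqn_leq h2 -ltnS h1.
Qed.

(** [L] is the limit superior, obtained as the infimum of the eventual upper bounds; anything
    smaller is exceeded arbitrarily late. *)
Lemma bounded_frequent_sup (f : nat -> R) : (forall k, 0 <= f k <= 1) ->
  exists L, [/\ 0 <= L,
    forall e, 0 < e -> \forall k \near \oo, f k <= L + e &
    exists kk : nat -> nat, forall i, (i <= kk i)%N /\ L - i.+1%:R^-1 < f (kk i)].
Proof.
move=> hf; pose A := [set x | \forall k \near \oo, f k <= x].
have A1 : A 1 by apply: nearW => k; case/andP: (hf k).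
have lbA : lbound A 0.
  move=> x Ax; have [k hk] := filter_ex Ax.
  by apply: le_trans hk; case/andP: (hf k).
have hinf : has_inf A by split; [exists 1 | exists 0].
exists (inf A); split.
- by apply: lb_le_inf => //; exists 1.
- move=> e e0; have [x Ax xe] := inf_adherent e0 hinf.
  by apply: filterS Ax => k /le_trans; apply; apply: ltW.
- have H (i : nat) : exists k, (i <= k)%N /\ inf A - i.+1%:R^-1 < f k.
    apply: contrapT => hn; suff : A (inf A - i.+1%:R^-1).
      move=> /(ge_inf hinf.2); rewrite lerBrDl gerDr; apply/negP.
      by rewrite -ltNge invr_gt0 ltr0n.
    exists i => // k /= ik; rewrite leNgt; apply/negP => hk.
    by apply: hn; exists k.
  by exists (fun i => projT1 (cid (H i))) => i; case: (cid (H i)).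
Qed.

End UltraConvergence.

(** * Limits of the block process *)

(** Complementary diagonal blocks of an orthogonal matrix are singular together. If [x] lives in
    block [p.2] and [x *m V] vanishes there, then [x *m V] lives in block [p.1], and [V^T] maps it
    back to [x], which vanishes on [p.1]. *)
Lemma block_inj_orth (R : fieldType) m n (b : 'I_n -> 'I_m) p (V : 'M[R]_n) :
  p.1 != p.2 -> V^T *m V = 1%:M -> elem_pattern b p V ->
  block_inj b V^T p.1 -> block_inj b V p.2.
Proof.
move=> p12 hV eV inj1 x hx hxV.
have xE : x *m V *m V^T = x by rewrite -mulmxA (mulmx1C hV) mulmx1.
suff y0 : x *m V = 0 by rewrite -xE y0 mul0mx.
apply: inj1 => [t ht|t ht]; last by rewrite xE hx ?ht.
have [/eqP ht2|ht2] := boolP (b t == p.2); first exact: hxV.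
rewrite (mul_elem_out _ _ eV) ?hx //.
by rewrite /in_pair negb_or ht ht2.
Qed.

Section BlockProcess.
Variables (R : realType) (m n : nat) (b : 'I_n -> 'I_m).
Variables (x0 : 'I_m * 'I_m) (w : seq ('I_m * 'I_m)).
Local Notation T := (size w).
Local Notation pv k := (nth x0 w (k %% T)).
Variables (A F U : nat -> 'M[R]_n).

Hypothesis w_gt0 : (0 < T)%N.
Hypothesis w_pair : forall p, p \in w -> p.1 != p.2.
Hypothesis w_cover : forall r, has (fun p => in_pair p r) w.
Hypothesis w_forces : forces_block_diag R w.
Hypothesis A_step : forall k, A k.+1 = (F k)^T *m A k *m F k.
Hypothesis A_sym0 : (A 0%N)^T = A 0%N.
Hypothesis U_orth : forall k, (U k)^T *m U k = 1%:M.
Hypothesis U_elem : forall k, elem_pattern b (pv k) (U k).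
Hypothesis FU : mxlim \oo (fun k => F k - U k) 0.

Definition tends_oo (W : set_system nat) (h : nat -> nat) : Prop :=
  forall N, \forall k \near W, (N <= h k)%N.

(** Assumption (A3) enters only through its effect on limits: the first diagonal pivot block of a
    limit of the [F k] is nonsingular. *)
Hypothesis F_inj : forall W h V p, UltraFilter W -> tends_oo W h ->
  (\forall k \near W, pv (h k) = p) -> mxlim W (F \o h) V ->
  block_inj b V p.1 /\ block_inj b V^T p.1.

Let pv_pair k : (pv k).1 != (pv k).2.
Proof. by apply: w_pair; rewrite mem_nth // ltn_pmod. Qed.

Lemma cvg_tends (W : set_system nat) (h : nat -> nat) (u : nat -> R) (l : R) :
  ProperFilter W -> tends_oo W h -> u @ \oo --> l -> (u \o h) @ W --> l.
Proof.
move=> PW hh ul; apply: cvg_comp ul => P [N _ hN].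
by apply: filterS (hh N) => k /= hk; apply: hN.
Qed.

Lemma process_sym k : (A k)^T = A k.
Proof. by elim: k => [//|k IH]; rewrite A_step !trmx_mul trmxK IH mulmxA. Qed.

Lemma process_zero k j : A k = 0 -> A (k + j)%N = 0.
Proof.
by move=> h; elim: j => [|j IH]; rewrite ?addn0 // addnS A_step IH mulmx0 mul0mx.
Qed.

Lemma U_le1 k s t : `|U k s t| <= 1.
Proof.
rewrite -(@ler_pXn2r _ 2) ?nnegrE // expr1n real_normK ?num_real //.
have := congr1 (fun M : 'M[R]_n => M t t) (U_orth k).
rewrite !mxE eqxx mulr1n => <-; rewrite (bigD1 s) //= mxE -expr2 lerDl.
by apply: sumr_ge0 => i _; rewrite mxE -expr2 sqr_ge0.
Qed.

(** [F] and [U] have a common limit [V]. It inherits orthogonality and the elementary pattern from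
    [U], and the nonsingular block at [p.1] from [F]; the block at [p.2] follows by
    orthogonality. *)
Lemma limit_step W h (a : nat -> R) p M : UltraFilter W -> tends_oo W h ->
  (\forall k \near W, pv (h k) = p) -> p.1 != p.2 ->
  mxlim W (fun k => a k *: A (h k)) M ->
  exists2 V, pivot_mx b p V & mxlim W (fun k => a k *: A (h k).+1) (V^T *m M *m V).
Proof.
move=> UW hh hp p12 hM; have PW : ProperFilter W by apply: ultra_proper.
have [V hV] : exists V, mxlim W (U \o h) V.
  by apply: (mxlim_exists (C := 1)) => //; apply: nearW => k s t; apply: U_le1.
have hF : mxlim W (F \o h) V.
  move=> s t; have := @FU s t; rewrite mxE => /(cvg_tends PW hh) h0.
  have h1 : (fun k => (F (h k) - U (h k)) s t + U (h k) s t) @ W --> 0 + V s t.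
    by apply: cvgD => //; apply: hV.
  rewrite add0r in h1; apply: (cvg_near_eq PW _ h1).
  by apply: nearW => k /=; rewrite !mxE /= subrK.
have V_orth : V^T *m V = 1%:M.
  apply: (mxlim_unique PW (mxlim_mul PW (mxlim_tr hV) hV)).
  apply: (mxlim_eq PW (X := fun=> 1%:M)); last exact: mxlim_cst.
  by apply: nearW => k /=; rewrite U_orth.
have V_elem : elem_pattern b p V.
  move=> s t hst; apply: (cvg_unique (@Rhausdorff R) (hV s t)).
  apply: (cvg_near_eq PW (f := fun=> (s == t)%:R)); last exact: cvg_cst.
  apply: filterS hp => k hk /=; rewrite -hk in hst.
  by rewrite (U_elem hst).
have [i1 i1'] := F_inj UW hh hp hF.
exists V.
  split=> //; split; first exact: (block_inj_orth p12 V_orth V_elem).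
  apply: (block_inj_orth p12 _ _ _); rewrite ?trmxK ?(mulmx1C V_orth) //.
  exact: elem_pattern_tr.
apply: (mxlim_eq PW _ (mxlim_mul PW (mxlim_mul PW (mxlim_tr hF) hM) hF)).
by apply: nearW => k /=; rewrite A_step -scalemxAr -scalemxAl.
Qed.

Lemma sqsum_inv_frob k : (frob_norm (A k))^-1 ^+ 2 = (sqsum (A k))^-1.
Proof. by rewrite exprVn frob_norm_sqr. Qed.

Lemma limit_exists W h : UltraFilter W ->
  exists M, mxlim W (fun k => (frob_norm (A (h k)))^-1 *: A (h k)) M.
Proof.
move=> UW; apply: (mxlim_exists (C := 1)); apply: nearW => k s t.
rewrite -(@ler_pXn2r _ 2) ?nnegrE // expr1n real_normK ?num_real //.
apply: (le_trans (sqr_le_sqsum _ s t)); rewrite sqsumZ sqsum_inv_frob.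
(* For a zero matrix the inverse norm is zero by convention, and the bound still holds. *)
have [->|ne] := eqVneq (sqsum (A (h k))) 0; first by rewrite mulr0.
by rewrite mulVf.
Qed.

(** Twice the square of the quotient in (ii); [pivot_ratio] plays the same part for (i). *)
Definition off_ratio k := off_sqsum (A k) / sqsum (A k).

Definition pivot_ratio k := off_sqsum (pivot_mask b (pv k) (A k.+1)) / sqsum (A k).

Lemma off_ratio_mul k : off_sqsum (A k) = off_ratio k * sqsum (A k).
Proof.
have [e|ne] := eqVneq (sqsum (A k)) 0; last by rewrite mulfVK.
rewrite e mulr0; apply/eqP; rewrite eq_le off_sqsum_ge0 andbT.
by rewrite -e off_sqsum_le.
Qed.

Lemma pivot_ratio_mul k :
  off_sqsum (pivot_mask b (pv k) (A k.+1)) = pivot_ratio k * sqsum (A k).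
Proof.
have [e|ne] := eqVneq (sqsum (A k)) 0; last by rewrite mulfVK.
rewrite e mulr0 -addn1 process_zero; last exact: sqsum_eq0.
by apply: off_sqsum_diag => s t _; rewrite !mxE if_same.
Qed.

Lemma off_ratio_bounds k : 0 <= off_ratio k <= 1.
Proof.
rewrite /off_ratio divr_ge0 ?off_sqsum_ge0 ?sqsum_ge0 //=.
have := sqsum_ge0 (A k); rewrite le_eqVlt => /orP[/eqP <-|h].
  by rewrite invr0 mulr0.
by rewrite ler_pdivrMr // mul1r off_sqsum_le.
Qed.

(** The pivot part of [A k.+1] is at most its whole off-diagonal part. The change of denominator
    from [A k.+1] to [A k] costs a factor that converges along every ultrafilter. *)
Lemma pivot_ratio_cvg0 : off_ratio @ \oo --> (0 : R) -> pivot_ratio @ \oo --> (0 : R).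
Proof.
move=> f0; apply: cvg_ultraP => W UW Woo; have PW : ProperFilter W by apply: ultra_proper.
have hid : tends_oo W id by move=> N; apply: Woo; exists N.
have [c hc] := ultra_finite_const UW (fun k => ltn_pmod k w_gt0).
have [M hM] := limit_exists id UW.
have hp : \forall k \near W, pv (id k) = nth x0 w c by apply: filterS hc => k /= ->.
have [k0 hk0] := filter_ex hc.
have p12 : (nth x0 w c).1 != (nth x0 w c).2 by rewrite -hk0; apply: pv_pair.
have [V hV hM'] := limit_step UW hid hp p12 hM.
have h1 : (fun k => off_ratio k.+1 * sqsum ((frob_norm (A k))^-1 *: A k.+1)) @ W --> (0 : R).
  rewrite -(mul0r (sqsum (V^T *m M *m V))); apply: cvgM; last exact: cvg_sqsum.
  by apply: (cvg_tends (h := succn) PW _ f0) => N; apply: filterS (hid N) => k /leqW.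
apply: (squeeze_cvgr _ (cvg_cst 0) h1); apply: nearW => k.
rewrite /pivot_ratio divr_ge0 ?off_sqsum_ge0 ?sqsum_ge0 //= sqsumZ sqsum_inv_frob mulrCA.
by rewrite -off_ratio_mul mulrC ler_wpM2l ?invr_ge0 ?sqsum_ge0 ?off_sqsum_mask_le.
Qed.

(* The rescaling by the norm of A (g i) is the same for all j, so that the
   recursion between the limits M j involves no further normalisation. *)
Lemma limit_process W (g : nat -> nat) : UltraFilter W -> tends_oo W g ->
  (forall i, g i %% T = 0)%N -> pivot_ratio @ \oo --> (0 : R) ->
  exists M : nat -> 'M[R]_n,
    (forall j, mxlim W (fun i => (frob_norm (A (g i)))^-1 *: A (g i + j)%N) (M j)) /\
    (forall j, [/\ (M j)^T = M j, sqsum (M j) = sqsum (M 0%N),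
       off_sqsum (M j.+1) = off_sqsum (M j) - off_sqsum (pivot_mask b (pv j) (M j)) &
       pivot_diag b (pv j) (M j) -> exact_step b (pv j) (M j) (M j.+1)]).
Proof.
move=> UW gg gT r0; have PW : ProperFilter W by apply: ultra_proper.
pose a i := (frob_norm (A (g i)))^-1.
have gj j : tends_oo W (fun i => g i + j)%N.
  by move=> N; apply: filterS (gg N) => i h; apply: leq_trans h (leq_addr _ _).
have pvj j : \forall i \near W, pv (g i + j)%N = pv j.
  by apply: nearW => i; rewrite -modnDml gT add0n.
have exM j : {M | mxlim W (fun i => a i *: A (g i + j)%N) M}.
  apply: cid; elim: j => [|j [M hM]].
    have [M hM] := limit_exists g UW; exists M.
    by apply: (mxlim_eq PW _ hM); apply: nearW => i; rewrite addn0.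
  have [V _ hV] := limit_step UW (gj j) (pvj j) (pv_pair j) hM.
  by exists (V^T *m M *m V); apply: (mxlim_eq PW _ hV); apply: nearW => i; rewrite addnS.
pose M j := projT1 (exM j); have hM j : mxlim W (fun i => a i *: A (g i + j)%N) (M j).
  by rewrite /M; case: (exM j).
have exV j : exists2 V, pivot_mx b (pv j) V & M j.+1 = V^T *m M j *m V.
  have [V hV hV'] := limit_step UW (gj j) (pvj j) (pv_pair j) (hM j).
  exists V => //; apply: (mxlim_unique PW (hM j.+1)).
  by apply: (mxlim_eq PW _ hV'); apply: nearW => i; rewrite addnS.
have Ms j : (M j)^T = M j.
  apply: (mxlim_unique PW (mxlim_tr (hM j))); apply: (mxlim_eq PW _ (hM j)).
  by apply: nearW => i; rewrite linearZ /= process_sym.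
(* Assertion (i) makes the pivot submatrix diagonal after each limiting step. *)
have Mpiv j : off_sqsum (pivot_mask b (pv j) (M j.+1)) = 0.
  have h1 := cvg_off_sqsum PW (mxlim_mask PW (b := b) (p := pv j) (hM j.+1)).
  have h2 : (fun i => pivot_ratio (g i + j)%N * sqsum (a i *: A (g i + j)%N)) @ W
      --> 0 * sqsum (M j).
    by apply: cvgM; [apply: (cvg_tends PW (gj j) r0)|apply: cvg_sqsum (hM j)].
  rewrite mul0r in h2; apply: (cvg_unique (@Rhausdorff R) h1).
  apply: (cvg_near_eq PW _ h2); apply: filterS (pvj j) => i hi.
  rewrite pivot_maskZ off_sqsumZ sqsumZ addnS -hi pivot_ratio_mul; ring.
exists M; split=> // j; have [V hV MS] := exV j; have [hVo hVe _ _] := hV.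
have hsq j' : sqsum (M j') = sqsum (M 0%N).
  by elim: j' => [//|j' IH]; have [V' [hV'o _ _ _] ->] := exV j'; rewrite sqsum_orth.
split=> //.
  have := off_sqsum_step (M j) hVo hVe; rewrite /= -MS Mpiv => <-.
  by rewrite subr0.
by move=> hd; split=> //; exact/off_sqsum_mask0.
Qed.

Lemma exact_proc_of_steps (M : nat -> 'M[R]_n) (x1 : 'I_m * 'I_m) v j0 :
  (forall j, (j < size v)%N -> exact_step b (nth x1 v j) (M (j0 + j)%N) (M (j0 + j).+1)) ->
  exact_proc b v (M j0) (M (j0 + size v)%N).
Proof.
elim: v j0 => [|p v IH] j0 H /=; first by rewrite addn0.
exists (M j0.+1); first by have := H 0%N isT; rewrite addn0.
rewrite addnS -addSn; apply: IH => j hj; have := H j.+1 hj.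
by rewrite addnS -addSn.
Qed.

Lemma exact_proc_of_pow (M : nat -> 'M[R]_n) K :
  (forall j, (j < K * T)%N -> exact_step b (pv j) (M j) (M j.+1)) ->
  exact_proc b (word_pow K w) (M 0%N) (M (K * T)%N).
Proof.
elim: K => [//|K IH] H; rewrite word_powSr; apply/exact_proc_cat.
exists (M (K * T)%N).
  by apply: IH => j hj; apply: H; apply: leq_trans hj _; rewrite leq_mul2r leqnSn orbT.
rewrite mulSn addnC; apply: (exact_proc_of_steps (x1 := x0)) => j hj.
have := H (K * T + j)%N; rewrite modnMDl modn_small //; apply.
by rewrite mulSn addnC ltn_add2r.
Qed.

Lemma off_ratio_cvg0 : pivot_ratio @ \oo --> (0 : R) -> off_ratio @ \oo --> (0 : R).
Proof.
move=> r0; have [L [L0 Lup [kk hkk]]] := bounded_frequent_sup off_ratio_bounds.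
have [L_gt0|] := ltP 0 L; last first.
  move=> L0'; have {L0 L0'} LE : L = 0 by apply/eqP; rewrite eq_le L0 L0'.
  apply/cvgrPdist_le => e e0; apply: filterS (Lup e e0) => k.
  rewrite LE add0r sub0r normrN ger0_norm //.
  by case/andP: (off_ratio_bounds k).
(* [K0] sweeps give block diagonality; the additional one ensures that every block has met a pivot,
   so that its diagonal block is diagonal too. *)
have [K0 hK0] := w_forces; pose K := K0.+1.
have [W [UW Woo]] := ultraFilterLemma (_ : ProperFilter \oo).
have PW : ProperFilter W by apply: ultra_proper.
(* At [q i] the ratio nearly reaches [L]. The start [g i] is a multiple of the sweep length, and
   [q i] lies [K] full sweeps and a remainder after it; the shift by [K * T] keeps the truncated
   subtraction exact. *)
pose q i := kk (i + K * T)%N; pose g i := (T * (q i %/ T - K))%N.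
have q_ge i : (i + K * T <= q i)%N by have [] := hkk (i + K * T)%N.
have qE i : q i = (g i + (K * T + q i %% T))%N.
  have hK : (K <= q i %/ T)%N.
    by rewrite leq_divRL //; apply: leq_trans (q_ge i); apply: leq_addl.
  rewrite addnA /g [(K * T)%N]mulnC -mulnDr subnK // [(T * _)%N]mulnC.
  exact: divn_eq.
have gg : tends_oo W g.
  move=> N; apply: Woo; exists (N + T)%N => // i /= hi.
  move: hi (q_ge i) (qE i) (ltn_pmod (q i) w_gt0).
  by move: (q i %% T)%N (K * T)%N (q i) (g i) => c KT qi gi; lia.
have [M [hM HM]] := limit_process UW gg (fun i => modnMr _ _) r0.
have [c hc] := ultra_finite_const UW (fun i => ltn_pmod (q i) w_gt0).
pose N := (K * T + c)%N.
have qN : \forall i \near W, q i = (g i + N)%N by apply: filterS hc => i /= hi; rewrite qE hi.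
pose a i := (frob_norm (A (g i)))^-1.
have iW : (fun i => L - (i + K * T)%N.+1%:R^-1 : R) @ W --> L.
  have : (fun i => L - i.+1%:R^-1 : R) @ \oo --> L - 0.
    by apply: cvgB; [exact: cvg_cst|exact: cvg_harmonic].
  rewrite subr0 => h; apply: (cvg_tends (h := fun i => (i + K * T)%N) PW _ h) => N'.
  by apply: Woo; exists N' => // i /= /leq_trans; apply; apply: leq_addr.
have fq i : L - (i + K * T)%N.+1%:R^-1 < off_ratio (q i) by have [] := hkk (i + K * T)%N.
(* If [A (g i)] were zero, so would be [A (q i)], and its ratio would be zero, below the positive
   lower bound. *)
have M1 : sqsum (M 0%N) = 1.
  apply: (cvg_unique (@Rhausdorff R) (cvg_sqsum PW (hM 0%N))).
  apply: (cvg_near_eq PW (f := fun=> 1)); last exact: cvg_cst.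
  have hpos : \forall i \near W, 0 < L - (i + K * T)%N.+1%:R^-1 by apply: cvgr_gt iW _ L_gt0.
  apply: filterS (filterI hpos qN) => i [hi hq] /=.
  rewrite addn0 sqsumZ sqsum_inv_frob mulVf //; apply/eqP => /sqsum_eq0 Ag.
  have := lt_trans hi (fq i); rewrite hq /off_ratio process_zero //.
  by rewrite off_sqsum_diag ?mul0r ?ltxx // => s t _; rewrite mxE.
(* The off-diagonal sum is at most [L] at the start, at least [L] at the end, and nonincreasing in
   between. It is thus constant, no step removes anything, and each pivot submatrix is already
   diagonal before its step. *)
have up : off_sqsum (M 0%N) <= L.
  apply/ler_addgt0Pr => e e0.
  apply: (cvgr_to_le (cvg_off_sqsum PW (hM 0%N))).
  have /= h := Lup e e0; have [N' _ hN'] := h.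
  apply: filterS (gg N') => i /hN' /=; rewrite addn0 off_sqsumZ sqsum_inv_frob.
  by rewrite mulrC.
have low : L <= off_sqsum (M N).
  (* The ratio at [q i] is relative to the norm of [A (q i)], whereas [M N] is scaled by that of
     [A (g i)]; the two agree in the limit because [sqsum (M N)] is 1. *)
  have h1 : (fun i => (L - (i + K * T)%N.+1%:R^-1) * sqsum (a i *: A (g i + N)%N)) @ W --> L.
    have [_ MN _ _] := HM N.
    have -> : nbhs L = nbhs (L * sqsum (M N)) by rewrite MN M1 mulr1.
    by apply: cvgM => //; apply: cvg_sqsum (hM N).
  rewrite -(cvg_lim (@Rhausdorff R) h1) -(cvg_lim (@Rhausdorff R) (cvg_off_sqsum PW (hM N))).
  apply: ler_lim; [by apply/cvg_ex; exists L| |].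
    by apply/cvg_ex; eexists; apply: cvg_off_sqsum (hM N).
  apply: filterS qN => i hi; rewrite off_sqsumZ off_ratio_mul mulrCA -sqsumZ -hi.
  by rewrite ler_wpM2r ?sqsum_ge0 // ltW.
have mono j d : off_sqsum (M (j + d)%N) <= off_sqsum (M j).
  elim: d => [|d IH]; rewrite ?addn0 // addnS; have [_ _ -> _] := HM (j + d)%N.
  by apply: le_trans IH; rewrite gerBl off_sqsum_ge0.
have offL j : (j <= N)%N -> off_sqsum (M j) = L.
  move=> jN; apply/eqP; rewrite eq_le; apply/andP; split.
    by apply: le_trans up; apply: (mono 0%N).
  by apply: le_trans low _; rewrite -(subnKC jN); apply: mono.
have step j : (j < N)%N -> exact_step b (pv j) (M j) (M j.+1).
  move=> jN; have [_ _ e] := HM j; apply; apply/off_sqsum_mask0.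
  rewrite (offL _ jN) (offL _ (ltnW jN)) in e; lra.
have KT_le : (K * T <= N)%N by apply: leq_addr.
have procM : exact_proc b (word_pow K w) (M 0%N) (M (K * T)%N).
  by apply: exact_proc_of_pow => j hj; apply: step; apply: leq_trans hj KT_le.
have diagM : block_diag b predT (M (K * T)%N).
  move: procM; rewrite word_powSr => /exact_proc_cat[B hB1 hB2].
  apply: (exact_proc_block_diagT hB2); apply: hK0 hB1.
  by have [] := HM 0%N.
have LE : L = 0.
  rewrite -(offL _ KT_le); apply: off_sqsum_diag.
  apply: (exact_proc_diag procM diagM) => r.
  by rewrite word_powSr has_cat w_cover orbT.
by rewrite LE ltxx in L_gt0.
Qed.

End BlockProcess.
(** * Smallest singular value *)

Section SmallestSingularValue.
Variables (R : realType) (d : nat).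
Implicit Types (x y : 'rV[R]_d) (H : 'M[R]_d).

Definition normsq x : R := \sum_k x 0 k ^+ 2.

Definition qform H x : R := (x *m H *m x^T) 0 0.

Lemma normsqE x : normsq x = (x *m x^T) 0 0.
Proof. by rewrite mxE; apply: eq_bigr => k _; rewrite mxE expr2. Qed.

Lemma normsq_ge0 x : 0 <= normsq x.
Proof. by apply: sumr_ge0 => k _; apply: sqr_ge0. Qed.

Lemma normsq_eq0 x : normsq x = 0 -> x = 0.
Proof.
move=> /eqP; rewrite psumr_eq0; last by move=> k _; apply: sqr_ge0.
move=> /allP h; apply/rowP => k; rewrite mxE; apply/eqP.
by rewrite -sqrf_eq0; apply: h; rewrite mem_index_enum.
Qed.

Lemma normsqZ a x : normsq (a *: x) = a ^+ 2 * normsq x.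
Proof. by rewrite mulr_sumr; apply: eq_bigr => k _; rewrite mxE exprMn. Qed.

Lemma qformZ H a x : qform H (a *: x) = a ^+ 2 * qform H x.
Proof.
by rewrite /qform linearZ /= -!scalemxAl -scalemxAr !mxE mulrA expr2.
Qed.

Lemma qformD H x y : H^T = H ->
  qform H (x + y) = qform H x + 2 * (x *m H *m y^T) 0 0 + qform H y.
Proof.
move=> Hs; have e : (y *m H *m x^T) 0 0 = (x *m H *m y^T) 0 0.
  transitivity ((y *m H *m x^T)^T 0 0); first by rewrite [RHS]mxE.
  by rewrite !trmx_mul trmxK Hs mulmxA.
have D (P Q : 'M[R]_1) : (P + Q) 0 0 = P 0 0 + Q 0 0 by rewrite mxE.
rewrite /qform linearD /= !mulmxDl !mulmxDr !D e; ring.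
Qed.

(* Minimality of x in the direction - x H. *)
Lemma qform_kernel H x : H^T = H -> (forall y, 0 <= qform H y) ->
  qform H x = 0 -> x *m H = 0.
Proof.
move=> Hs Hpos x0; set y := x *m H; apply: normsq_eq0.
have key e : 0 < e -> 2 * normsq y <= e * qform H y.
  move=> e0; have := Hpos (x + (- e) *: y).
  rewrite qformD // x0 add0r qformZ linearZ /= -scalemxAr mxE -/y -normsqE sqrrN.
  rewrite -(pmulr_rge0 _ (_ : 0 < e^-1)) ?invr_gt0 // mulrDr.
  have -> : e^-1 * (2 * (- e * normsq y)) = - (2 * normsq y) by field; rewrite gt_eqF.
  have -> : e^-1 * (e ^+ 2 * qform H y) = e * qform H y by field; rewrite gt_eqF.
  by rewrite addrC subr_ge0.
apply/eqP; rewrite eq_le normsq_ge0 andbT; apply/ler_addgt0Pr => e e0; rewrite add0r.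
have q1 : 0 < qform H y + 1 by rewrite ltr_wpDl.
(* This step length makes the right-hand side of [key] at most [e]; the added 1 keeps the
   denominator positive. *)
have := key (e / (qform H y + 1)) (divr_gt0 e0 q1) => h.
have : e / (qform H y + 1) * qform H y <= e.
  by rewrite mulrAC ler_pdivrMr // (ler_pM2l e0) lerDl.
by have := normsq_ge0 y; lra.
Qed.

Lemma continuous_normsq : continuous normsq.
Proof.
move=> x; apply: (cvg_sum_seq (W := nbhs x) (f := fun k (y : 'rV[R]_d) => y 0 k ^+ 2)).
by move=> k; apply: cvgM; apply: coord_continuous.
Qed.

Lemma continuous_qform H : continuous (qform H).
Proof.
have -> : qform H = fun x => \sum_k (\sum_j x 0 j * H j k) * x 0 k.
  apply/funext => x; rewrite /qform mxE; apply: eq_bigr => k _.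
  by rewrite !mxE.
move=> x; apply: (cvg_sum_seq (W := nbhs x)
  (f := fun k (y : 'rV[R]_d) => (\sum_j y 0 j * H j k) * y 0 k)) => k.
apply: cvgM; last exact: coord_continuous.
apply: (cvg_sum_seq (W := nbhs x) (f := fun j (y : 'rV[R]_d) => y 0 j * H j k)) => j.
by apply: cvgM; [apply: coord_continuous|apply: cvg_cst].
Qed.

(** The Rayleigh quotient attains its minimum on the unit sphere, which is closed in a cube and
    hence compact; homogeneity extends the bound to all vectors. *)
Lemma qform_min H : (0 < d)%N -> exists2 c, normsq c = 1 &
  forall x, qform H c * normsq x <= qform H x.
Proof.
move=> d0; pose S := [set x : 'rV[R]_d | normsq x = 1].
have S0 : S !=set0.
  exists (delta_mx 0 (Ordinal d0)); rewrite /S /= /normsq (bigD1 (Ordinal d0)) //=.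
  rewrite big1 => [|k kd]; rewrite mxE !eqxx ?expr1n ?addr0 //=.
  by rewrite (negbTE kd) expr0n.
have cS : compact S.
  apply: (subclosed_compact _ (rV_compact (fun=> @segment_compact R (- 1) 1))).
    have -> : S = normsq @^-1` [set 1] by [].
    apply: preimage_closed => [x _|]; first exact: continuous_normsq.
    exact: closed_eq.
  move=> x Sx i /=; rewrite in_itv /= -ler_norml.
  rewrite -(@ler_pXn2r _ 2) ?nnegrE // expr1n real_normK ?num_real //.
  rewrite -Sx /normsq (bigD1 i) //= lerDl.
  by apply: sumr_ge0 => k _; apply: sqr_ge0.
have [c cS1 cmin] := EVT_min_rV S0 cS (continuous_subspaceT (@continuous_qform H)).
exists c => [|x]; first by rewrite inE in cS1.
have [/normsq_eq0 ->|x1] := eqVneq (normsq x) 0.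
  by rewrite -(scale0r 0) qformZ normsqZ expr0n !mul0r mulr0.
have x0 : 0 < normsq x by rewrite lt_neqAle eq_sym x1 normsq_ge0.
have sq : (Num.sqrt (normsq x))^-1 ^+ 2 = (normsq x)^-1 by rewrite exprVn sqr_sqrtr ?ltW.
have := cmin ((Num.sqrt (normsq x))^-1 *: x); rewrite inE /S /= normsqZ sq mulVf //.
by move=> /(_ erefl); rewrite qformZ sq mulrC ler_pdivlMr.
Qed.

Lemma sigma_min_ge0 (B : 'M[R]_d) : 0 <= sigma_min B.
Proof.
rewrite /sigma_min; have [->|/set0P ne] := eqVneq (singular_values B) set0.
  by rewrite inf0.
by apply: lb_le_inf => // s [].
Qed.

(** The minimum [mu] of the Rayleigh quotient of [G = B^T *m B] is an eigenvalue: [G - mu%:M] is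
    positive semidefinite with zero form at the minimiser, which thus lies in its kernel. So
    [Num.sqrt mu] is a singular value. *)
Lemma sigma_min_le (B : 'M[R]_d) x : (0 < d)%N ->
  sigma_min B ^+ 2 * normsq x <= normsq (x *m B^T).
Proof.
move=> d0; pose G := B^T *m B.
have GE y : qform G y = normsq (y *m B^T).
  by rewrite normsqE trmx_mul trmxK /qform /G !mulmxA.
have Gs : G^T = G by rewrite /G trmx_mul trmxK.
have [c c1 cmin] := qform_min G d0; set mu := qform G c in cmin.
have mu0 : 0 <= mu by rewrite /mu GE normsq_ge0.
rewrite -GE; apply: le_trans (cmin x); apply: ler_wpM2r; first exact: normsq_ge0.
have HE y : qform (G - mu%:M) y = qform G y - mu * normsq y.
  have D (P Q : 'M[R]_1) : (P - Q) 0 0 = P 0 0 - Q 0 0 by rewrite !mxE.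
  have Z (P : 'M[R]_1) : (mu *: P) 0 0 = mu * P 0 0 by rewrite mxE.
  by rewrite /qform mulmxBr mulmxBl D mul_mx_scalar -scalemxAl Z normsqE.
have ker : c *m (G - mu%:M) = 0.
  apply: qform_kernel => [|y|].
  - by rewrite linearB /= tr_scalar_mx Gs.
  - by rewrite HE subr_ge0.
  - by rewrite HE c1 mulr1 subrr.
have sv : singular_values B (Num.sqrt mu).
  split; first exact: sqrtr_ge0.
  rewrite sqr_sqrtr //; apply/eigenvalueP; exists c.
    by move: ker; rewrite mulmxBr mul_mx_scalar => /eqP; rewrite subr_eq0 => /eqP.
  apply/eqP => c0; move: c1; rewrite c0 -(scale0r 0) normsqZ expr0n mul0r => /eqP.
  by rewrite eq_sym oner_eq0.
have le_s : sigma_min B <= Num.sqrt mu by apply: ge_inf => //; exists 0 => s [].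
by rewrite -(sqr_sqrtr mu0) ler_pXn2r ?nnegrE ?sqrtr_ge0 ?sigma_min_ge0.
Qed.

End SmallestSingularValue.

(** * Pivot submatrices *)

Section BlockMatrices.
Variables (R : realType) (m : nat) (nu : 'I_m -> nat).
Local Notation n := (\sum_(r < m) nu r)%N.
Local Notation blk := (@tagnat.sig1 m nu).
Implicit Types (X V : 'M[R]_n) (i j : 'I_m).

Lemma elem_block_pattern i j (Uh : 'M[R]_(nu i + nu j)) :
  elem_pattern blk (i, j) (elem_block_mx Uh).
Proof.
move=> s t hst; have := @submxblock_elem R m nu i j (blk s) (blk t) Uh.
rewrite !inE => /(_ hst) /matrixP /(_ (tagnat.sig2 s) (tagnat.sig2 t)).
by rewrite !mxE !tagnat.sig2K.
Qed.

Lemma block_inj_unit V i : submxblock V i i \in unitmx -> block_inj blk V i.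
Proof.
move=> hV x hx hxV.
have sub0 (y : 'rV[R]_n) r : (forall s, blk s = r -> y 0 s = 0) -> submxrow y r = 0.
  by move=> hy; apply/rowP => k; rewrite !mxE hy ?tagnat.Rank1K.
have hx' r : r != i -> submxrow x r = 0.
  by move=> ri; apply: sub0 => s hs; rewrite hx // hs.
have hi : submxrow x i = 0.
  have := sub0 _ _ hxV; rewrite -[x in x *m V]submxrowK -[V in _ *m V]submxblockK.
  rewrite mul_mxrow_mxblock mxrowK (bigD1 i) //= big1 ?addr0; last first.
    by move=> r ri; rewrite hx' ?mul0mx.
  by move=> /(congr1 (mulmx^~ (invmx (submxblock V i i)))); rewrite mulmxK // mul0mx.
apply/rowP => s; rewrite mxE.
have [e|ne] := eqVneq (blk s) i; last exact: hx.
have := congr1 (fun y : 'rV_(nu (blk s)) => y 0 (tagnat.sig2 s))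
  (_ : submxrow x (blk s) = 0); rewrite !mxE tagnat.sig2K; apply.
by rewrite e.
Qed.

Section Pivot.
Variables i j : 'I_m.
Hypothesis ij : i != j.

(** The position in the full matrix of an index of the pivot submatrix; it turns [pivot_submx] into
    an [mxsub], and sums over the pivot blocks into sums over the submatrix. *)
Definition pivot_index (k : 'I_(nu i + nu j)) : 'I_n :=
  match fintype.split k with inl k1 => tagnat.Rank i k1 | inr k2 => tagnat.Rank j k2 end.

Lemma pivot_submxE X : pivot_submx X i j = mxsub pivot_index pivot_index X.
Proof.
apply/matrixP => k l; rewrite !mxE /pivot_index.
by case: fintype.split => k'; rewrite !mxE; case: fintype.split => l'; rewrite !mxE.
Qed.

Lemma pivot_index_inj : injective pivot_index.
Proof.
move=> k l; rewrite /pivot_index -{2}(splitK k) -{2}(splitK l).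
have RI r : injective (@tagnat.Rank m nu r).
  move=> a b /(congr1 (@nat_of_ord _)) /eqP.
  by rewrite tagnat.eq_Rank eqxx /= => /eqP /val_inj.
have ne a b : tagnat.Rank i a <> tagnat.Rank j b :> 'I_n.
  by move=> /(congr1 blk); rewrite !tagnat.Rank1K; apply/eqP.
case: (fintype.split k) => a; case: (fintype.split l) => c;
  [by move=> /RI ->|by move=> /ne|by move=> /esym /ne|by move=> /RI ->].
Qed.

Lemma sum_pivot_index (G : 'I_n -> R) :
  \sum_(s | in_pair (i, j) (blk s)) G s = \sum_k G (pivot_index k).
Proof.
transitivity (\sum_(s in (pivot_index @: [set: 'I_(nu i + nu j)])%SET) G s); last first.
  rewrite big_imset /= => [|k l _ _]; last exact: pivot_index_inj.
  by apply: eq_bigl => k; rewrite finset.in_setT.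
have ex r s : blk s = r -> exists k : 'I_(nu r), s = tagnat.Rank r k.
  by move=> <-; exists (tagnat.sig2 s); rewrite tagnat.sig2K.
apply: eq_bigl => s; apply/orP/imsetP => [[/eqP /ex[k ->]|/eqP /ex[k ->]]|[k _ ->]] /=.
- exists (lshift _ k); rewrite ?inE // /pivot_index.
  by rewrite -[lshift _ _]/(unsplit (inl k)) unsplitK.
- exists (rshift _ k); rewrite ?inE // /pivot_index.
  by rewrite -[rshift _ _]/(unsplit (inr k)) unsplitK.
- by rewrite /pivot_index; case: fintype.split => a; rewrite tagnat.Rank1K eqxx; [left|right].
Qed.

Lemma pivot_index_in k : in_pair (i, j) (blk (pivot_index k)).
Proof.
by rewrite /pivot_index /in_pair; case: fintype.split => a; rewrite tagnat.Rank1K eqxx ?orbT.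
Qed.

Lemma off_sqsum_pivot X :
  off_sqsum (pivot_submx X i j) = off_sqsum (pivot_mask blk (i, j) X).
Proof.
rewrite pivot_submxE /off_sqsum.
rewrite [RHS](bigID (fun s => in_pair (i, j) (blk s))) /= [X in _ + X]big1 ?addr0; last first.
  by move=> s hs; rewrite big1 // => t _; rewrite mxE (negbTE hs) expr0n.
rewrite sum_pivot_index; apply: eq_bigr => k _.
rewrite [RHS](bigID (fun s => in_pair (i, j) (blk s))) /= [X in _ + X]big1 ?addr0; last first.
  by move=> s /andP[_ hs]; rewrite mxE (negbTE hs) andbF expr0n.
rewrite [RHS]big_andbC big_mkcondr sum_pivot_index -big_mkcond /=.
apply: eq_big => [l|l _]; first by rewrite (inj_eq pivot_index_inj).
by rewrite !mxE !pivot_index_in.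
Qed.

(** Columns of an elementary block matrix with pivot index vanish outside the pivot rows, so
    restriction to the pivot commutes with the congruence. The matrix in (i) is therefore the pivot
    submatrix of the next iterate. *)
Lemma pivot_submx_congr X (Fh : 'M[R]_(nu i + nu j)) :
  pivot_submx ((elem_block_mx Fh)^T *m X *m elem_block_mx Fh) i j
  = Fh^T *m pivot_submx X i j *m Fh.
Proof.
have FhE : mxsub pivot_index pivot_index (elem_block_mx Fh) = Fh.
  by rewrite -pivot_submxE pivot_submx_elem.
set F := elem_block_mx Fh in FhE *.
have hF : elem_pattern blk (i, j) F := elem_block_pattern Fh.
have mulF (Z : 'M[R]_n) :
    mxsub pivot_index pivot_index (Z *m F) = mxsub pivot_index pivot_index Z *m Fh.
  apply/matrixP => k l; rewrite !mxE (bigID (fun t => in_pair (i, j) (blk t))) /=.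
  rewrite [X in _ + X]big1 ?addr0; last first.
    move=> t ht; rewrite hF ?negb_and ?ht //; case: eqP => [tl|_]; last by rewrite mulr0.
    by rewrite tl pivot_index_in in ht.
  by rewrite sum_pivot_index; apply: eq_bigr => q _; rewrite -FhE !mxE.
rewrite !pivot_submxE mulF -[F^T *m X]trmxK trmx_mul trmxK -trmx_mxsub mulF.
by rewrite trmx_mul trmx_mxsub trmxK.
Qed.

End Pivot.
End BlockMatrices.

(** * Nonsingular limit blocks from (A3), and the equivalence *)

Lemma limn_einf_gt0 (R : realType) (u : nat -> R) :
  (0 < limn_einf (fun k => (u k)%:E))%E ->
  exists2 c, 0 < c & \forall k \near \oo, c <= u k.
Proof.
set v := fun k => _; rewrite limn_einf_lim.
rewrite (cvg_lim _ (ereal_nondecreasing_cvgn (nondecreasing_einfs v))) //.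
move=> /ereal_sup_gt [_ [N _ <-]] hN.
have hle k : (N <= k)%N -> (einfs v N <= (u k)%:E)%E.
  by move=> Nk; apply: ereal_inf_lbound; exists k.
(* Some tail infimum is positive; it is finite because [u N] bounds it above. *)
exists (fine (einfs v N)).
  apply: fine_gt0; rewrite hN /=; apply: le_lt_trans (hle N (leqnn N)) _.
  exact: ltry.
exists N => // k /= Nk; rewrite -lee_fin fineK ?hle //.
rewrite fin_real // (lt_le_trans _ (ltW hN)) ?ltNyr //=.
exact: le_lt_trans (hle N (leqnn N)) (ltry _).
Qed.

(** The lower bound [c] on the length of [x *m (submxblock (X k) i i)^T] for unit [x] passes to the
    limit, so the limit block has trivial kernel. *)
Lemma limit_block_inj (R : realType) m (nu : 'I_m -> nat) (W : set_system nat)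
    (X : nat -> 'M[R]_(\sum_(r < m) nu r)) V i (c : R) :
  ProperFilter W -> (0 < nu i)%N -> 0 < c ->
  (\forall k \near W, c <= sigma_min (submxblock (X k) i i)) -> mxlim W X V ->
  block_inj (@tagnat.sig1 m nu) V i /\ block_inj (@tagnat.sig1 m nu) V^T i.
Proof.
move=> PW nui c0 hc hX; set Vi := submxblock V i i.
have le x : c ^+ 2 * normsq x <= normsq (x *m Vi^T).
  have hXi : mxlim W (fun k => x *m (submxblock (X k) i i)^T) (x *m Vi^T).
    apply: (mxlim_mul PW (X := fun=> x)); first exact: mxlim_cst.
    apply: mxlim_tr => s t.
    by rewrite mxE; apply: (cvg_near_eq PW _ (hX _ _)); apply: nearW => k; rewrite mxE.
  have hcv : (fun k => normsq (x *m (submxblock (X k) i i)^T)) @ W --> normsq (x *m Vi^T).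
    by apply: cvg_sum_seq => k; apply: cvgM; apply: hXi.
  apply: (cvgr_to_ge hcv); apply: filterS hc => k hk.
  apply: le_trans (sigma_min_le (submxblock (X k) i i) x nui).
  by rewrite ler_wpM2r ?normsq_ge0 // ler_pXn2r ?nnegrE ?sigma_min_ge0 // ltW.
have Vu : Vi \in unitmx.
  rewrite -unitmx_tr -row_free_unit; apply/inj_row_free => x hx.
  apply: normsq_eq0; apply/eqP; rewrite eq_le normsq_ge0 andbT.
  have := le x; rewrite hx -(scale0r 0) normsqZ expr0n mul0r.
  by rewrite pmulr_rle0 // exprn_gt0.
split; apply: block_inj_unit => //.
by rewrite -tr_submxblock unitmx_tr.
Qed.

Lemma cvg0_sqr (R : realType) (u v : nat -> R) : (forall k, 0 <= u k) ->
  (forall k, v k = 2 * u k ^+ 2) -> u @ \oo --> (0 : R) <-> v @ \oo --> (0 : R).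
Proof.
move=> u0 vE; split=> h.
  have -> : v = fun k => 2 * (u k * u k) by apply/funext => k; rewrite vE expr2.
  have -> : nbhs (0 : R) = nbhs (2 * (0 * 0) : R) by rewrite !mulr0.
  by apply: cvgM; [apply: cvg_cst|apply: cvgM].
have -> : u = fun k => Num.sqrt (2^-1 * v k).
  by apply/funext => k; rewrite vE mulKf ?pnatr_eq0 // sqrtr_sqr ger0_norm.
have -> : nbhs (0 : R) = nbhs (Num.sqrt (2^-1 * 0) : R) by rewrite mulr0 sqrtr0.
apply: continuous_cvg; first exact: sqrt_continuous.
by apply: cvgM => //; apply: cvg_cst.
Qed.

Theorem theorem5p1 (R : realType) (m : nat) (hm : (1 < m)%N)
  (nu : 'I_m -> nat) (nu_gt0 : forall r, (0 < nu r)%N)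
  (O : seq ('I_m * 'I_m)) (hO : generalized_serial O)
  (A : 'M[R]_(\sum_(r < m) nu r)) (A_neq0 : A <> 0) (A_sym : A^T = A)
  (Fh : forall k : nat, 'M[R]_(nu (pivot hm O k).1 + nu (pivot hm O k).2))
  (Fh_unit : forall k, Fh k \in unitmx)
  (F : nat -> 'M[R]_(\sum_(r < m) nu r))
  (F_def : forall k, F k = elem_block_mx (Fh k))
  (Ak : nat -> 'M[R]_(\sum_(r < m) nu r))
  (Ak0 : Ak 0%N = A)
  (AkS : forall k, Ak k.+1 = (F k)^T *m Ak k *m F k)
  (A2 : exists (U : nat -> 'M[R]_(\sum_(r < m) nu r)) (Uh : forall k : nat,
            'M[R]_(nu (pivot hm O k).1 + nu (pivot hm O k).2)),
      [/\ forall k, U k = elem_block_mx (Uh k),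
          forall k, orthogonal_mx (U k)
        & (fun k => F k - U k) @ \oo --> (0 : 'M[R]_(\sum_(r < m) nu r))])
  (A3 : (0 < limn_einf (fun k =>
      (sigma_min (submxblock (F k) (pivot hm O k).1 (pivot hm O k).1))%:E))%E) :
  (fun k =>
     off_norm ((Fh k)^T *m
               pivot_submx (Ak k) (pivot hm O k).1 (pivot hm O k).2 *m Fh k)
     / frob_norm (Ak k)) @ \oo --> (0 : R)
  <->
  (fun k => off_norm (Ak k) / frob_norm (Ak k)) @ \oo --> (0 : R).
Proof.
have [pairO coverO] := hO.1.
pose x0 : 'I_m * 'I_m := (Ordinal (ltnW hm), Ordinal hm).
have x0O : x0 \in O by apply: coverO.
have O_gt0 : (0 < size O)%N by case: (O) x0O.
have O_pair p : p \in O -> p.1 != p.2.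
  by move=> /(allP pairO); rewrite /is_pair -val_eqE neq_ltn => ->.
(* Block 0 is met by the pair [(0, 1)], and any other block [r] by [(0, r)]. *)
have O_cover (r : 'I_m) : has (fun p => in_pair p r) O.
  apply/hasP; have [r0|r0] := posnP r.
    by exists x0; rewrite // /in_pair -val_eqE /= r0.
  exists (x0.1, r); first exact: coverO.
  by rewrite /in_pair eqxx orbT.
have pivot_neq k : (pivot hm O k).1 != (pivot hm O k).2.
  by apply: O_pair; rewrite mem_nth // ltn_pmod.
have [U [Uh [U_def U_orth FU]]] := A2.
pose b := @tagnat.sig1 m nu.
have U_elem k : elem_pattern b (nth x0 O (k %% size O)) (U k).
  by rewrite U_def; move: (elem_block_pattern (Uh k)); rewrite -surjective_pairing.
have FU0 : mxlim \oo (fun k => F k - U k) 0.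
  by move=> s t; apply: (cvg_comp _ _ FU (@coord_continuous R _ _ s t _)).
have A_sym0 : (Ak 0%N)^T = Ak 0%N by rewrite Ak0.
have [c c0 hc] := limn_einf_gt0 A3.
have F_inj W h V p : UltraFilter W -> tends_oo W h ->
    (\forall k \near W, nth x0 O (h k %% size O) = p) -> mxlim W (F \o h) V ->
    block_inj b V p.1 /\ block_inj b V^T p.1.
  move=> UW hh hp hV; have PW : ProperFilter W by apply: ultra_proper.
  apply: (limit_block_inj PW (nu_gt0 _) c0 _ hV).
  have [N _ hN] := hc; apply: filterS (filterI (hh N) hp) => k [hk <-].
  exact: hN.
have A_symk k : (Ak k)^T = Ak k := process_sym AkS A_sym0 k.
have frobE k (u : R) : (u / frob_norm (Ak k)) ^+ 2 = u ^+ 2 / sqsum (Ak k).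
  by rewrite exprMn exprVn frob_norm_sqr.
have iE : (fun k => off_norm ((Fh k)^T *m
      pivot_submx (Ak k) (pivot hm O k).1 (pivot hm O k).2 *m Fh k)
      / frob_norm (Ak k)) @ \oo --> (0 : R)
    <-> pivot_ratio b x0 O Ak @ \oo --> (0 : R).
  apply: cvg0_sqr => k; first by rewrite divr_ge0 ?sqrtr_ge0.
  rewrite frobE mulrA -off_norm_sqr.
    by rewrite -pivot_submx_congr // -F_def -AkS off_sqsum_pivot.
  by rewrite -pivot_submx_congr // -F_def -AkS pivot_submxE trmx_mxsub A_symk.
have iiE : (fun k => off_norm (Ak k) / frob_norm (Ak k)) @ \oo --> (0 : R)
    <-> off_ratio Ak @ \oo --> (0 : R).
  apply: cvg0_sqr => k; first by rewrite divr_ge0 ?sqrtr_ge0.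
  by rewrite frobE mulrA -off_norm_sqr.
rewrite iE iiE; split=> [|].
  exact: (off_ratio_cvg0 O_gt0 O_pair O_cover (forces_generalized_serial R hO) AkS A_sym0
    U_orth U_elem FU0 F_inj).
exact: (pivot_ratio_cvg0 O_gt0 O_pair AkS U_orth U_elem FU0 F_inj).
Qed.
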